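(* Let $n\geq 3$, let $m$ be an integer with $1\leq m<\frac{n}{2}$, let $-\infty<a<2m$ and $1<p<+\infty$, and let $u$ be a nonnegative (classical) solution of $$(-\Delta)^{m}u(x)=\frac{u^{p}(x)}{|x|^{a}} \ \text{ in } \mathbb{R}^{n},\qquad u(x)\geq 0,\ x\in\mathbb{R}^{n}.$$ If at least one of the following two assumptions holds: (1) $-\infty<a\leq 2+2p$, or (2) $u(x)=o(|x|^{2})$ as $|x|\to+\infty$, then $$(-\Delta)^{i}u(x)\geq 0$$ for every $i=1,2,\dots,m-1$ and all $x\in\mathbb{R}^{n}$.
   Context: Solution class: a nonnegative (classical) solution is a function $u\geq 0$ with $u\in C^{2m}(\mathbb{R}^{n})$ if $-\infty<a\leq 0$, and $u\in C^{2m}(\mathbb{R}^{n}\setminus\{0\})\cap C^{2m-2}(\mathbb{R}^{n})$ if $0<a<2m$, which satisfies the equation pointwise (for $a>0$, at every $x\neq 0$). *)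

(* Defs.v *)
From HB Require Import structures.
From mathcomp Require Import all_boot all_order all_algebra.
From mathcomp Require Import all_classical all_reals all_analysis.
Set Implicit Arguments.
Unset Strict Implicit.
Unset Printing Implicit Defensive.
Import Order.TTheory GRing.Theory Num.Theory.
Import numFieldNormedType.Exports.
Local Open Scope classical_set_scope.
Local Open Scope ring_scope.

(* R^n is 'rV[R]_n. Its library norm `|x| is the sup norm, which induces the
   usual topology but is not the |x| of the equation; hence enorm. *)
Definition enorm (R : realType) (n : nat) (x : 'rV[R]_n) : R :=
  Num.sqrt (\sum_(i < n) x 0 i ^+ 2).

Definition partial (R : realType) (n : nat) (i : 'I_n) (f : 'rV[R]_n -> R) :
    'rV[R]_n -> R :=
  fun x => 'D_(delta_mx 0 i) f x.

(* All partial derivatives of order at most k, mixed ones included, exist and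
   are continuous on D. Meant for open D: derivatives and limits at a point of
   D are the unrestricted ones. *)
Fixpoint Ck (R : realType) (n : nat) (k : nat) (D : set 'rV[R]_n)
    (f : 'rV[R]_n -> R) : Prop :=
  (forall x, D x -> {for x, continuous f}) /\
  match k with
  | 0 => True
  | k'.+1 => forall i : 'I_n,
      (forall x, D x -> derivable f x (delta_mx 0 i)) /\ Ck k' D (partial i f)
  end.

Definition laplacian (R : realType) (n : nat) (f : 'rV[R]_n -> R) :
    'rV[R]_n -> R :=
  fun x => \sum_(i < n) partial i (partial i f) x.

Definition neg_laplacian_iter (R : realType) (n : nat) (k : nat)
    (f : 'rV[R]_n -> R) : 'rV[R]_n -> R :=
  iter k (fun g x => - laplacian g x) f.

(* At x = 0 the equation is only imposed when a <= 0. There the library's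
   powR has 0 `^ 0 = 1 and 0 `^ a = 0 = 0^-1 for a < 0, so dividing by
   enorm x `^ a is multiplying by |x|^(-a), as it should be. *)
Definition hardy_henon_eq (R : realType) (n m : nat) (a p : R)
    (u : 'rV[R]_n -> R) (x : 'rV[R]_n) : Prop :=
  neg_laplacian_iter m u x = u x `^ p / enorm x `^ a.

Definition nonneg_classical_solution (R : realType) (n m : nat) (a p : R)
    (u : 'rV[R]_n -> R) : Prop :=
  [/\ forall x, 0 <= u x,
      a <= 0 -> Ck (2 * m) setT u /\ forall x, hardy_henon_eq m a p u x
    & 0 < a ->
      [/\ Ck (2 * m) [set x | x != 0] u, Ck (2 * m - 2) setT u
        & forall x, x != 0 -> hardy_henon_eq m a p u x]].

Definition at_infty (R : realType) (n : nat) : set_system 'rV[R]_n :=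
  filter_from setT (fun M : R => [set x | M < enorm x]).
Arguments at_infty : clear implicits.

Global Instance at_infty_filter (R : realType) (n : nat) :
  Filter (at_infty R n).
Proof.
apply: filter_from_filter; first by exists 0.
move=> M N _ _; exists (Num.max M N) => // x /=.
by rewrite gt_max => /andP[].
Qed.

Canonical at_infty_filter_on (R : realType) (n : nat) :=
  FilterType (at_infty R n) (@at_infty_filter R n).

(* Main.v *)
Require Import Defs.
From HB Require Import structures.
From mathcomp Require Import all_boot all_order all_algebra.
From mathcomp Require Import all_classical all_reals all_analysis.
From mathcomp Require Import ring lra zify.
Set Implicit Arguments.
Unset Strict Implicit.
Unset Printing Implicit Defensive.
Import Order.TTheory GRing.Theory Num.Theory.
Import numFieldNormedType.Exports.
Local Open Scope classical_set_scope.
Local Open Scope ring_scope.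

(** Write [u_j] for [(-Delta)^j u]. The signs are obtained by descending
    induction on [j]: the equation makes [u_m >= 0] away from the origin, and
    [u_{j+1} >= 0] says that [u_j] is superharmonic. A superharmonic [u_j]
    dominates at each point [c] its weighted means over balls centred at [c]
    ([superharmonic_mean_le]). Integrating by parts [j] times moves the
    Laplacians from [u_j] onto the weight, so that the mean over the ball of
    radius [r] is at most [C r^(-2j)] times a mean of [u] over the same ball
    ([iter_moments_controlled]). If the means of [u] stay bounded as [r] grows,
    letting [r] tend to infinity gives [u_j(c) >= 0] for every [j >= 1]
    ([superharmonic_ge0]).

    The means of [u] do stay bounded because of the nonlinearity
    ([average_bound]). Testing the equation against a weight [psi] on the ball
    of radius [r] bounds the integral of [|x|^(-a) u^p psi] by [C r^(-2m)] times
    the integral of [u] against another such weight. On this ball [|x|^(-a)] is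
    at least of order [r^(-2m)] off the unit ball, as [a < 2m], and [p > 1], so
    that Young's inequality absorbs the right-hand side up to a multiple of the
    volume of the ball.

    Two choices keep the argument elementary. First, the integral only has to be
    a positive linear functional on bounded functions of bounded support that
    kills the derivatives of compactly supported functions, has the right order
    of magnitude on small balls, and is positive on large ones; a limit of
    Riemann sums along an ultrafilter has these properties ([gint]), the
    vanishing on derivatives coming from the invariance of the sums under
    translations of the grid. Second, all the weights are the bumps
    [(1 - |x - c|^2 / r^2)_+ ^ k], whose Laplacians are again combinations of
    bumps ([bump_C2]). The same identity shows that the means of a superharmonic
    function increase with [k], while the weights concentrate at [c]; this is
    the mean value inequality.

    At the origin [u] may have only [2m - 2] derivatives, so that [u_{m-1}] is
    merely continuous there. Cutting off a ball of radius [e] costs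
    [O(e^(n-2))], hence in dimension at least 3 the origin is removable
    ([green_punctured]). *)

(** * Riemann sums on a grid *)

Lemma row_norm_leP (R : realType) (n : nat) (x : 'rV[R]_n) (L : R) : 0 <= L ->
  reflect (forall i, `|x 0 i| <= L) (`|x| <= L).
Proof.
move=> L0; rewrite [leLHS]/Num.norm /= mx_normrE; apply: (iffP (bigmax_leP _ _ _ _)).
  by move=> [_ h] i; exact: (h (0, i)).
by move=> h; split=> // -[i j] _ /=; rewrite ord1.
Qed.

Section RiemannSums.
Variables (R : realType) (n : nat).

(** The grid of step [1 / N.+1] on the cube of half-side [N.+1]: both the mesh and
    the cube have to exhaust the space in the limit. *)
Definition node (N : nat) (k : 'I_(2 * N.+1 ^ 2).+1) : R :=
  k%:R / N.+1%:R - N.+1%:R.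

Definition grid (N : nat) (k : {ffun 'I_n -> 'I_(2 * N.+1 ^ 2).+1}) : 'rV[R]_n :=
  \row_i node (k i).

Definition riemann_sum (f : 'rV[R]_n -> R) (N : nat) : R :=
  (\sum_k f (grid (N := N) k)) / N.+1%:R ^+ n.

(** An interval of length [2 * L] meets at most [2 * L * N.+1 + 1] nodes, the
    upper half of the estimate of the volume of a cube. *)
Lemma node_count_le (N : nat) (L : R) : 0 <= L ->
  \sum_(j < (2 * N.+1 ^ 2).+1) (`|node j| <= L)%R%:R <= 2 * L * N.+1%:R + 1 :> R.
Proof.
move=> L0; set K := (2 * N.+1 ^ 2).+1; set c := Num.truncn (L * N.+1%:R).
have Np : 0 < N.+1%:R :> R by rewrite ltr0n.
have cle : c%:R <= L * N.+1%:R by rewrite truncn_le// mulr_ge0.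
have ltc : L * N.+1%:R < c.+1%:R by rewrite truncnS_gt.
have range (j : 'I_K) : `|node j| <= L -> (N.+1 ^ 2 <= j + c)%N /\ (j <= N.+1 ^ 2 + c)%N.
  have -> : node j = (j%:R - (N.+1 ^ 2)%:R) / N.+1%:R.
    rewrite /node natrX; field; exact: lt0r_neq0.
  rewrite normrM normfV (ger0_norm (ltW Np)) ler_pdivrMr// => h.
  have {}h : `|j%:R - (N.+1 ^ 2)%:R| < c.+1%:R :> R by exact: le_lt_trans ltc.
  move: h; rewrite ltr_norml => /andP[h1 h2].
  split.
    have : (N.+1 ^ 2)%:R < (j + c.+1)%:R :> R by rewrite natrD; lra.
    by rewrite ltr_nat; lia.
  have : j%:R < (N.+1 ^ 2 + c.+1)%:R :> R by rewrite natrD; lra.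
  by rewrite ltr_nat; lia.
rewrite -natr_sum -big_mkcond /= sum1_card.
have -> : #|[pred j : 'I_K | `|node j| <= L]| =
  #|[set j : 'I_K | `|node j| <= L]%SET|.
  by apply: eq_card => j; rewrite !inE.
set A := [set j | _]%SET.
have : (#|A| <= c.*2.+1)%N.
  pose g (j : 'I_K) : 'I_(c.*2.+1) := inord (j + c - N.+1 ^ 2).
  rewrite -[X in (_ <= X)%N]card_ord; rewrite -(card_in_imset (f := g)).
    exact: max_card.
  move=> i j; rewrite !inE => /range[i1 i2] /range[j1 j2] /(congr1 val) /=.
  rewrite !inordK; try by rewrite ltnS; lia.
  by move=> e; apply/val_inj => /=; lia.
rewrite -(ler_nat R) => /le_trans; apply.
by rewrite -addn1 natrD lerD2r// -mul2n natrM -mulrA ler_pM2l.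
Qed.

Lemma node_count_ge (N : nat) :
  N.+1%:R <= \sum_(j < (2 * N.+1 ^ 2).+1) (`|node j| <= 1)%R%:R :> R.
Proof.
set K := (2 * N.+1 ^ 2).+1.
rewrite -natr_sum -big_mkcond /= sum1_card ler_nat.
have bnd (i : 'I_N.+1) : (N.+1 ^ 2 + i < K)%N by case: i => i /=; rewrite /K; nia.
have inj : injective (fun i : 'I_N.+1 => Ordinal (bnd i)).
  by move=> i j [] /addnI /val_inj.
rewrite -[X in (X <= _)%N](card_ord N.+1) -(fintype.card_image inj).
apply/subset_leq_card/fintype.subsetP => _ /mapP[i _ ->].
change (`|node (Ordinal (bnd i))| <= 1); rewrite /node /= natrD.
have Np : 0 < N.+1%:R :> R by rewrite ltr0n.
have -> : ((N.+1 ^ 2)%:R + i%:R) / N.+1%:R - N.+1%:R = i%:R / N.+1%:R :> R.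
  rewrite natrX; field; exact: lt0r_neq0.
rewrite ger0_norm ?divr_ge0// ler_pdivrMr// mul1r ler_nat; exact/ltnW.
Qed.

Lemma sum_grid_prod (N : nat) (F : R -> R) :
  \sum_k \prod_i F (grid (N := N) k 0 i) = (\sum_j F (node (N := N) j)) ^+ n.
Proof.
rewrite -[RHS](_ : \prod_(i < n) \sum_j F (node (N := N) j) = _); last first.
  by rewrite prodr_const card_ord.
rewrite (bigA_distr_bigA (fun (i : 'I_n) j => F (node (N := N) j))) /=.
by apply: eq_bigr => k _; apply: eq_bigr => i _; rewrite mxE.
Qed.

Lemma riemann_sum_bound (N : nat) (f : 'rV[R]_n -> R) (L M : R) :
  0 <= L -> 0 <= M ->
  (forall x, `|f x| <= M) -> (forall x, L < `|x| -> f x = 0) ->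
  `|riemann_sum f N| <= M * (2 * L + N.+1%:R^-1) ^+ n.
Proof.
move=> L0 M0 fM f0.
have Np : 0 < N.+1%:R :> R by rewrite ltr0n.
have Nn : 0 < N.+1%:R ^+ n :> R by exact: exprn_gt0.
rewrite normrM normfV (gtr0_norm Nn) ler_pdivrMr// -mulrA -exprMn.
have -> : (2 * L + N.+1%:R^-1) * N.+1%:R = 2 * L * N.+1%:R + 1.
  by field; exact: lt0r_neq0.
apply: le_trans (ler_norm_sum _ _ _) _.
apply: (@le_trans _ _ (\sum_k M * \prod_i (`|grid (N := N) k 0 i| <= L)%R%:R)).
  apply: ler_sum => k _; have [kL|] := leP `|grid k| L; last first.
    by move=> /f0->; rewrite normr0 mulr_ge0// prodr_ge0.
  rewrite big1 ?mulr1// => i _.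
  by move/row_norm_leP : kL => -> .
rewrite -mulr_sumr ler_wpM2l// (sum_grid_prod _ (fun y => (`|y| <= L)%R%:R)).
by rewrite lerXn2r ?nnegrE ?sumr_ge0// ?node_count_le// addr_ge0// !mulr_ge0.
Qed.

Lemma riemann_sum_unit_box (N : nat) (f : 'rV[R]_n -> R) (c : R) : 0 <= c ->
  (forall x, 0 <= f x) -> (forall x, `|x| <= 1 -> c <= f x) ->
  c <= riemann_sum f N.
Proof.
move=> c0 f0 fc.
have Nn : 0 < N.+1%:R ^+ n :> R by rewrite exprn_gt0// ltr0n.
rewrite ler_pdivlMr//.
apply: (@le_trans _ _ (\sum_k c * \prod_i (`|grid (N := N) k 0 i| <= 1)%R%:R)).
  rewrite -mulr_sumr ler_wpM2l// (sum_grid_prod _ (fun y => (`|y| <= 1)%R%:R)).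
  by rewrite lerXn2r ?nnegrE ?sumr_ge0// node_count_ge.
apply: ler_sum => k _; have [/fc kc|k1] := leP `|grid k| 1.
  rewrite (le_trans _ kc)// -[leRHS]mulr1 ler_wpM2l// prodr_ile1// => i.
  by rewrite ler0n lern1 leq_b1.
suff -> : \prod_i (`|grid (N := N) k 0 i| <= 1)%R%:R = 0 :> R by rewrite mulr0.
have /existsNP[i /negP/negbTE ki] : ~ (forall i, `|grid k 0 i| <= 1).
  by move/row_norm_leP => /(_ ler01); rewrite leNgt k1.
by rewrite (bigD1 i)//= ki mul0r.
Qed.

Lemma riemann_sumD (f g : 'rV[R]_n -> R) (N : nat) :
  riemann_sum (f \+ g) N = riemann_sum f N + riemann_sum g N.
Proof. by rewrite /riemann_sum big_split mulrDl. Qed.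

Lemma riemann_sumZ (c : R) (f : 'rV[R]_n -> R) (N : nat) :
  riemann_sum (c \*o f) N = c * riemann_sum f N.
Proof. by rewrite /riemann_sum -mulr_sumr mulrA. Qed.

Lemma le_riemann_sum (f g : 'rV[R]_n -> R) (N : nat) : (forall x, f x <= g x) ->
  riemann_sum f N <= riemann_sum g N.
Proof.
by move=> fg; rewrite ler_pM2r ?invr_gt0 ?exprn_gt0 ?ltr0n//; exact: ler_sum.
Qed.

(** A function supported well inside the cube has the same sum over the grid and
    over the translated grid. This exact invariance makes the integral of a
    derivative vanish in the limit. *)
Lemma riemann_sum_shift (N : nat) (i : 'I_n) (f : 'rV[R]_n -> R) (L : R) :
  0 <= L -> L < N.+1%:R -> (forall x, L < `|x| -> f x = 0) ->
  riemann_sum (fun x => f (x + N.+1%:R^-1 *: delta_mx 0 i)) N = riemann_sum f N.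
Proof.
move=> L0 LN f0; congr (_ / _).
have Np : 0 < N.+1%:R :> R by rewrite ltr0n.
have big (x : 'rV[R]_n) (j : 'I_n) : N.+1%:R <= `|x 0 j| -> f x = 0.
  move=> xj; apply: f0; rewrite ltNge; apply/negP => /row_norm_leP => /(_ L0 j).
  by rewrite leNgt (lt_le_trans LN xj).
(* The index is shifted cyclically: where it wraps around, both the point that
   leaves the grid and the one that enters it lie outside the support. *)
pose sh (k : {ffun 'I_n -> 'I_(2 * N.+1 ^ 2).+1}) :=
  [ffun j => if j == i then ordS (k j) else k j].
pose shi (k : {ffun 'I_n -> 'I_(2 * N.+1 ^ 2).+1}) :=
  [ffun j => if j == i then ord_pred (k j) else k j].
have shK : cancel sh shi.
  by move=> k; apply/ffunP => j; rewrite !ffunE; case: eqP => // _; rewrite ordSK.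
have shiK : cancel shi sh.
  by move=> k; apply/ffunP => j; rewrite !ffunE; case: eqP => // _; rewrite ord_predK.
rewrite [RHS](reindex sh) /=; last by exists shi => k _; [exact: shK|exact: shiK].
apply: eq_bigr => k _.
have [kmax|kmax] := eqVneq (k i : nat) (2 * N.+1 ^ 2)%N.
  rewrite (big _ i) ?(big (grid (sh k)) i)//.
    rewrite mxE ffunE eqxx /node /= kmax modnn mul0r add0r normrN ger0_norm//.
  rewrite !mxE !eqxx mulr1 /node kmax natrM natrX.
  rewrite (_ : 2 * N.+1%:R ^+ 2 / N.+1%:R - N.+1%:R + N.+1%:R^-1 = N.+1%:R + N.+1%:R^-1).
    by rewrite ger0_norm ?lerDl ?addr_ge0 ?invr_ge0.
  by field; exact: lt0r_neq0.
congr f; apply/rowP => j; rewrite !mxE ffunE eqxx /=.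
case: eqP => [->|_]; last by rewrite mulr0 addr0.
rewrite mulr1 /node /= modn_small; last by have := ltn_ord (k i); lia.
by rewrite -[in RHS]addn1 natrD; field; exact: lt0r_neq0.
Qed.

End RiemannSums.

(** * A positive linear functional *)

Section GridIntegral.
Variables (R : realType) (n : nat).
Implicit Types f g : 'rV[R]_n -> R.

Definition grid_ultrafilter : set_system nat :=
  sval (cid (ultraFilterLemma eventually_filter)).

Lemma grid_ultrafilterP : UltraFilter grid_ultrafilter.
Proof. by rewrite /grid_ultrafilter; case: cid => U [? ?]. Qed.

#[global] Instance grid_ultrafilter_proper : ProperFilter grid_ultrafilter.
Proof. exact: @ultra_proper grid_ultrafilterP. Qed.

Lemma grid_ultrafilter_eventually (A : set nat) :
  (\forall N \near \oo, A N) -> \forall N \near grid_ultrafilter, A N.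
Proof. by move: A; rewrite /grid_ultrafilter; case: cid => U [? ?]. Qed.

(** Along an ultrafilter every bounded sequence converges, so that the limit of
    the Riemann sums exists, and is linear, for all bounded functions of bounded
    support, without any regularity. For a continuous one it is its integral. *)
Definition gint (f : 'rV[R]_n -> R) : R :=
  lim (riemann_sum f N @[N --> grid_ultrafilter]).

Definition bnd_supp (f : 'rV[R]_n -> R) : Prop :=
  exists L M : R, [/\ 0 <= L, 0 <= M, forall x, `|f x| <= M
    & forall x, L < `|x| -> f x = 0].

Lemma eventually_invn_le (e : R) : 0 < e -> \forall N \near \oo, N.+1%:R^-1 <= e.
Proof.
move=> e0; have := @near_infty_natSinv_lt R (PosNum e0).
by apply: filterS => N /ltW.
Qed.

Lemma gint_cvg f : bnd_supp f ->
  riemann_sum f N @[N --> grid_ultrafilter] --> gint f.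
Proof.
move=> [L [M [L0 M0 fM fL]]]; apply/cvg_ex.
set C := M * (2 * L + 1) ^+ n.
have [|l [_ clusl]] := @segment_compact R (- C) C
    (riemann_sum f N @[N --> grid_ultrafilter]) _; last first.
  exists l => V lV.
  have [//|UV] := in_ultra_setVsetC (riemann_sum f @^-1` V) grid_ultrafilterP.
  by have [r []] := clusl (~` V) V UV lV.
apply: (@filterE _ grid_ultrafilter) => N /=; rewrite in_itv /= -ler_norml.
rewrite (le_trans (riemann_sum_bound N L0 M0 fM fL))// ler_wpM2l//.
have N0 : 0 <= N.+1%:R^-1 :> R by rewrite invr_ge0.
rewrite lerXn2r ?nnegrE ?addr_ge0 ?mulr_ge0// lerD2l invf_le1//.
by rewrite ler1n.
Qed.

Lemma gintD f g : bnd_supp f -> bnd_supp g -> gint (f \+ g) = gint f + gint g.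
Proof.
move=> bf bg; apply/cvg_lim => //; rewrite (_ : riemann_sum _ = riemann_sum f \+ riemann_sum g).
  by apply: cvgD; exact: gint_cvg.
by apply/funext => N; exact: riemann_sumD.
Qed.

Lemma gintZ c f : bnd_supp f -> gint (c \*o f) = c * gint f.
Proof.
move=> bf; apply/cvg_lim => //; rewrite (_ : riemann_sum _ = c \*o riemann_sum f).
  by apply: cvgMr; exact: gint_cvg.
by apply/funext => N; exact: riemann_sumZ.
Qed.

Lemma le_gint f g : bnd_supp f -> bnd_supp g -> (forall x, f x <= g x) ->
  gint f <= gint g.
Proof.
move=> bf bg fg; apply: ler_cvg_to (gint_cvg bf) (gint_cvg bg) _.
by apply: filterE => N; exact: le_riemann_sum.
Qed.

Lemma gint_bound f L M : 0 < L -> 0 <= M -> (forall x, `|f x| <= M) ->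
  (forall x, L < `|x| -> f x = 0) -> `|gint f| <= M * (3 * L) ^+ n.
Proof.
move=> L0 M0 fM fL; have bf : bnd_supp f by exists L, M; split=> //; exact: ltW.
suff h : \forall N \near grid_ultrafilter, `|riemann_sum f N| <= M * (3 * L) ^+ n.
  rewrite ler_norml; apply/andP; split.
    apply: (ler_cvg_to (f := fun=> _) (cvg_cst _) (gint_cvg bf)).
    by apply: filterS h => N; rewrite ler_norml => /andP[].
  apply: (ler_cvg_to (g := fun=> _) (gint_cvg bf) (cvg_cst _)).
  by apply: filterS h => N; rewrite ler_norml => /andP[].
apply: grid_ultrafilter_eventually; apply: filterS (eventually_invn_le L0) => N NL.
rewrite (le_trans (riemann_sum_bound N (ltW L0) M0 fM fL))// ler_wpM2l//.
move: N.+1%:R^-1 (invr_ge0 (N.+1%:R : R)) NL => v; rewrite ler0n => v0 vL.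
by rewrite lerXn2r ?nnegrE//; lra.
Qed.

(** The source of strict positivity: the moments of a bump of large radius are not
    zero. *)
Lemma gint_unit_box f c : bnd_supp f -> 0 <= c -> (forall x, 0 <= f x) ->
  (forall x, `|x| <= 1 -> c <= f x) -> c <= gint f.
Proof.
move=> bf c0 f0 fc; apply: (ler_cvg_to (f := fun=> _) (cvg_cst _) (gint_cvg bf)).
by apply: filterE => N; exact: riemann_sum_unit_box.
Qed.

Lemma bnd_suppD f g : bnd_supp f -> bnd_supp g -> bnd_supp (f \+ g).
Proof.
move=> [L [M [L0 M0 fM fL]]] [L' [M' [L'0 M'0 gM gL]]].
exists (Num.max L L'), (M + M'); split=> [||x|x].
- by rewrite le_max L0.
- exact: addr_ge0.
- by rewrite (le_trans (ler_normD _ _))// lerD.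
- by rewrite gt_max /= => /andP[/fL-> /gL->]; rewrite addr0.
Qed.

(** Boundedness on balls is all that is asked from the factor that multiplies
    a test function. *)
Definition ball_bounded (f : 'rV[R]_n -> R) : Prop :=
  forall L : R, exists2 M : R, 0 <= M & forall x, `|x| <= L -> `|f x| <= M.

Lemma bnd_suppM f g : ball_bounded f -> bnd_supp g -> bnd_supp (f \* g).
Proof.
move=> bf [L [M [L0 M0 gM gL]]]; have [K K0 fK] := bf L.
exists L, (K * M); split=> [||x|x /gL /= ->]; rewrite ?mulr0 ?mulr_ge0//.
have [xL|/gL xL] := leP `|x| L; first by rewrite normrM ler_pM// fK.
by rewrite /= xL mulr0 normr0 mulr_ge0.
Qed.

Lemma bnd_suppZ c f : bnd_supp f -> bnd_supp (c \*o f).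
Proof. by apply: (@bnd_suppM (fun=> c)) => L; exists `|c|. Qed.

Lemma bnd_supp_dom f g : (forall x, `|f x| <= g x) -> bnd_supp g -> bnd_supp f.
Proof.
move=> fg [L [M [L0 M0 gM gL]]]; exists L, M; split=> // x.
  by rewrite (le_trans (fg x))// (le_trans (ler_norm _)).
by move=> /gL gx; apply/eqP; rewrite -normr_le0 -gx.
Qed.

Lemma closed_ball_compact (L : R) : compact [set x : 'rV[R]_n | `|x| <= L].
Proof.
apply: bounded_closed_compact.
  exists L; split; first exact: num_real.
  by move=> M LM x /= xL; rewrite (le_trans xL)// ltW.
rewrite (_ : [set _ | _] = Num.norm @^-1` [set y | y <= L])//.
by apply: closed_comp => [x _|]; [exact: norm_continuous|exact: closed_le].
Qed.

Lemma continuous_ball_bounded f : continuous f -> ball_bounded f.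
Proof.
move=> cf L.
have /compact_bounded[M [Mr h]] : compact (f @` [set x | `|x| <= L]).
  apply: continuous_compact; last exact: closed_ball_compact.
  exact: continuous_subspaceT.
exists (`|M| + 1); first by rewrite addr_ge0.
move=> x xL; apply: (h (`|M| + 1)); last by exists x.
by rewrite (le_lt_trans (ler_norm _))// ltrDl.
Qed.

End GridIntegral.

(** * Green's formula *)

Lemma is_derive_line (R : realType) (V : normedModType R) (F : V -> R) (x e : V)
    (s d : R) :
  is_derive (x + s *: e) e F d -> is_derive s 1 (fun t => F (x + t *: e)) d.
Proof.
have E : (fun h => h^-1 *: (F (x + (h *: 1 + s) *: e) - F (x + s *: e))) =
         (fun h => h^-1 *: (F (h *: e + (x + s *: e)) - F (x + s *: e))).
  by apply/funext => h; rewrite scaler1 scalerDl addrCA.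
move=> [dF <-]; apply: DeriveDef; first by rewrite /derivable E.
by rewrite /derive E.
Qed.

Lemma continuous_ball_unif (R : realType) (n : nat) (G : 'rV[R]_n -> R) (L e : R) :
  continuous G -> 0 < e ->
  exists2 d, 0 < d & forall x y, `|x| <= L -> `|y - x| < d -> `|G y - G x| <= e.
Proof.
move=> cG e0; have e20 : 0 < e / 2 by rewrite divr_gt0.
have /compact_near_coveringP := @closed_ball_compact R n L.
move=> /(_ R 0^'+ (fun d x => forall y, `|y - x| < d -> `|G y - G x| <= e)) [].
  move=> x _; have /cvgrPdist_lt/(_ _ e20) := cG x.
  move=> /nbhs_ballP[r /= r0 rG].
  exists (ball x (r / 2), [set d | d < r / 2]).
    split; first by apply: nbhsx_ballx; rewrite divr_gt0.
    by apply: nbhs_right_lt; rewrite divr_gt0.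
  move=> [x' d] /= [xx' dr] y yx'.
  have h1 : `|G x - G x'| < e / 2.
    by apply: rG; apply: le_ball xx'; rewrite ler_pdivrMr// ler_peMr ?ler1n// ltW.
  have h2 : `|G x - G y| < e / 2.
    apply: rG; rewrite -ball_normE /=; move: xx'; rewrite -ball_normE /= => xx'.
    rewrite (_ : x - y = (x - x') - (y - x')); last by rewrite opprB addrA subrK.
    rewrite (le_lt_trans (ler_normB _ _))// [r]splitr ltrD//.
    exact: lt_trans dr.
  rewrite (_ : G y - G x' = (G x - G x') - (G x - G y)); last by ring.
  by rewrite (le_trans (ler_normB _ _))// [e]splitr lerD// ltW.
move=> d /= d0 h; exists (d / 2); first by rewrite divr_gt0.
move=> x y xL; apply: h => //=; last by rewrite divr_gt0.
by rewrite distrC subr0 gtr0_norm ?divr_gt0// ltr_pdivrMr// ltr_pMr// ltr1n.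
Qed.

Lemma norm_delta_le1 (R : realType) (n : nat) (i : 'I_n) :
  `|delta_mx 0 i : 'rV[R]_n| <= 1.
Proof.
by apply/row_norm_leP => // j; rewrite mxE eqxx /=; case: eqP; rewrite ?normr1 ?normr0.
Qed.

(** [G] is uniformly close to the difference quotient of [F] with step the mesh of
    the grid, and the Riemann sums of these quotients vanish by translation
    invariance. *)
Lemma gint_partial0 (R : realType) (n : nat) (F G : 'rV[R]_n -> R) (i : 'I_n) (L : R) :
  (forall x, is_derive x (delta_mx 0 i) F (G x)) -> continuous G ->
  (forall x, L < `|x| -> F x = 0) -> (forall x, L < `|x| -> G x = 0) ->
  gint G = 0.
Proof.
move=> FG cG F0 G0.
wlog L0 : L F0 G0 / 0 <= L.
  move=> /(_ `|L|); apply => // x; [move=> h; apply: F0|move=> h; apply: G0];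
    exact: le_lt_trans (ler_norm _) h.
have bG : bnd_supp G.
  have [M M0 GM] := continuous_ball_bounded cG L.
  exists L, M; split=> // x; have [/GM//|/G0->] := leP `|x| L.
  by rewrite normr0.
set C := (2 * (L + 1) + 1) ^+ n.
have C0 : 0 <= C by rewrite exprn_ge0// !(addr_ge0, mulr_ge0).
suff bound e : 0 < e -> `|gint G| <= e * C.
  apply/eqP; rewrite -normr_le0; apply/ler_addgt0Pr => e e0; rewrite add0r.
  have C1 : 0 < C + 1 by rewrite ltr_wpDl.
  rewrite (le_trans (bound (e / (C + 1)) _)) ?divr_gt0//.
  by rewrite -mulrA ger_pMr// mulrC ler_pdivrMr// mul1r lerDl.
move=> e0; have [d d0 dG] := continuous_ball_unif (L + 1) cG e0.
have near_bound : \forall N \near grid_ultrafilter, `|riemann_sum G N| <= e * C.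
  apply: grid_ultrafilter_eventually.
  have d20 : 0 < Num.min (d / 2) 1 by rewrite lt_min ltr01 divr_gt0.
  have N_large : \forall N \near \oo, L < N.+1%:R.
    near=> N; have : L <= N%:R by near: N; exact: nbhs_infty_ger.
    by move=> /le_lt_trans; apply; rewrite ltr_nat.
  apply: filterS2 (eventually_invn_le d20) N_large => N.
  have N0 : 0 < N.+1%:R :> R by rewrite ltr0n.
  set h := N.+1%:R^-1; rewrite le_min => /andP[hd h1] LN.
  have h0 : 0 < h by rewrite invr_gt0.
  have hd' : h < d by rewrite (le_lt_trans hd)// ltr_pdivrMr// ltr_pMr// ltr1n.
  pose Q x := h^-1 * (F (x + h *: delta_mx 0 i) - F x).
  have Q0 : riemann_sum Q N = 0.
    rewrite (_ : Q = h^-1 \*o ((fun x => F (x + h *: delta_mx 0 i)) \+ (-1) \*o F)).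
      rewrite riemann_sumZ riemann_sumD riemann_sumZ.
      by rewrite (riemann_sum_shift i L0 LN F0) mulN1r subrr mulr0.
    by apply/funext => x /=; rewrite mulN1r.
  have -> : riemann_sum G N = riemann_sum (G \+ (-1) \*o Q) N.
    by rewrite riemann_sumD riemann_sumZ Q0 mulr0 addr0.
  apply: (@le_trans _ _ (e * (2 * (L + 1) + h) ^+ n)); last first.
    rewrite ler_wpM2l ?(ltW e0)// lerXn2r ?nnegrE ?lerD2l//.
    by rewrite !(addr_ge0, mulr_ge0)// ltW.
    by rewrite !(addr_ge0, mulr_ge0).
  have far (x : 'rV[R]_n) : L + 1 < `|x| ->
      [/\ G x = 0, F x = 0 & F (x + h *: delta_mx 0 i) = 0].
    move=> xL; have Lx : L < `|x| by rewrite (le_lt_trans _ xL)// lerDl.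
    split; [exact: G0|exact: F0|apply: F0].
    have := lerB_normD x (h *: delta_mx 0 i); apply: lt_le_trans.
    rewrite ltrBrDr; apply: le_lt_trans xL; rewrite lerD2l normrZ gtr0_norm//.
    by rewrite (le_trans _ h1)// ger_pMr// norm_delta_le1.
  apply: riemann_sum_bound; [by rewrite addr_ge0|exact: ltW| |]; last first.
    by move=> x /far[Gx Fx Fxh] /=; rewrite /Q Gx Fx Fxh subrr !mulr0 addr0.
  move=> x; have [xL|/far[Gx Fx Fxh]] := leP `|x| (L + 1); last first.
    by rewrite /Q /= Gx Fx Fxh subrr !mulr0 addr0 normr0 ltW.
  have [] := @MVT R (fun t => F (x + t *: delta_mx 0 i))
    (fun t => G (x + t *: delta_mx 0 i)) 0 h h0.
  - by move=> t _; exact: is_derive_line.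
  - apply: derivable_within_continuous => t _.
    by have [] := is_derive_line (FG (x + t *: delta_mx 0 i)).
  move=> c; rewrite in_itv /= scale0r addr0 subr0 => /andP[c0 ch] E.
  have QE : Q x = G (x + c *: delta_mx 0 i).
    by rewrite /Q E mulrC mulfK// lt0r_neq0.
  rewrite /= QE mulN1r distrC.
  apply: dG => //; rewrite addrC addKr normrZ gtr0_norm//.
  by rewrite (le_lt_trans _ (lt_trans ch hd'))// ger_pMr// norm_delta_le1.
have cG' : `|riemann_sum G N| @[N --> grid_ultrafilter] --> `|gint G|.
  exact: cvg_norm (gint_cvg bG).
by apply: (ler_cvg_to (g := fun=> _) cG' (cvg_cst _)).
Unshelve. all: by end_near. Qed.

(** [g i] and [d i] are the first and the second derivative of [f] in the
    direction of the [i]-th axis; only pure second derivatives matter for the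
    Laplacian. *)
Definition C2_data (R : realType) (n : nat) (D : set 'rV[R]_n) (f : 'rV[R]_n -> R)
    (g d : 'I_n -> 'rV[R]_n -> R) : Prop :=
  (forall x, D x -> {for x, continuous f}) /\
  forall i x, D x ->
    [/\ is_derive x (delta_mx 0 i) f (g i x),
        is_derive x (delta_mx 0 i) (g i) (d i x),
        {for x, continuous (g i)} & {for x, continuous (d i)}].

Definition lap (R : realType) (n : nat) (d : 'I_n -> 'rV[R]_n -> R) (x : 'rV[R]_n) : R :=
  \sum_(i < n) d i x.

Lemma is_derive_near0 (R : realType) (V : normedModType R) (f : V -> R) (x v : V) (d : R) :
  is_derive x v f d -> (\forall y \near x, f y = 0) -> d = 0.
Proof.
move=> [_ <-] f0; rewrite (near_eq_derive (g := fun=> 0) v f0).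
exact: derive_cst.
Qed.

(** Testing against [phi] requires that its derivatives vanish near the points where
    [phi] does; this spares support hypotheses on them. *)
Lemma C2_data_near0 (R : realType) (n : nat) (f : 'rV[R]_n -> R) g d (x : 'rV[R]_n) i :
  C2_data setT f g d -> (\forall y \near x, f y = 0) ->
  (\forall y \near x, g i y = 0) /\ (\forall y \near x, d i y = 0).
Proof.
move=> [_ fgd] f0.
have g0 : \forall y \near x, g i y = 0.
  apply: filterS (near_join f0) => y f0y.
  by have [fg _ _ _] := fgd i y I; exact: is_derive_near0 fg f0y.
split=> //; apply: filterS (near_join g0) => y g0y.
by have [_ gd _ _] := fgd i y I; exact: is_derive_near0 gd g0y.
Qed.

Lemma continuousMc (R : realType) (T : topologicalType) (c : R) (f : T -> R) (x : T) :
  {for x, continuous f} -> {for x, continuous (c \*o f)}.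
Proof. by move=> cf; apply: (@continuousM _ _ (fun=> c)) => //; exact: cst_continuous. Qed.

(** Here and below [h] is only regular on [D], and [phi] vanishes near the complement
    of [D]: the product does not see the singular points. *)
Lemma cutoffM_continuous (R : realType) (n : nat) (D : set 'rV[R]_n)
    (h phi : 'rV[R]_n -> R) :
  (forall x, D x -> {for x, continuous h}) -> continuous phi ->
  (forall x, ~ D x -> \forall y \near x, phi y = 0) -> continuous (h \* phi).
Proof.
move=> ch cphi phi0 x; have [Dx|/phi0 Dx] := pselect (D x).
  by apply: continuousM; [exact: ch|exact: cphi].
have E : \forall y \near x, 0 = (h \* phi) y.
  by apply: filterS Dx => y /= ->; rewrite mulr0.
rewrite /continuous_at -(nbhs_singleton E).
exact: cvg_trans (near_eq_cvg E) (cvg_cst _).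
Qed.

Lemma near_gt_norm (R : realType) (n : nat) (L : R) (x : 'rV[R]_n) :
  L < `|x| -> \forall y \near x, L < `|y|.
Proof.
exact: cvgr_gt (@norm_continuous _ _ x) _.
Qed.

Lemma gint_sum (R : realType) (n : nat) (I : finType) (F : I -> 'rV[R]_n -> R) :
  (forall i, bnd_supp (F i)) ->
  gint (fun x => \sum_i F i x) = \sum_i gint (F i).
Proof.
move=> bF.
suff aux (s : seq I) : bnd_supp (fun x => \sum_(i <- s) F i x) /\
    gint (fun x => \sum_(i <- s) F i x) = \sum_(i <- s) gint (F i).
  exact: (aux (index_enum I)).2.
elim: s => [|i s [bs IH]].
  have b0 : @bnd_supp R n (fun=> 0) by exists 0, 0; split=> // x; rewrite normr0.
  rewrite (_ : (fun x => \sum_(i <- [::]) F i x) = fun=> 0); last first.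
    by apply/funext => x; rewrite big_nil.
  split=> //; rewrite big_nil; transitivity (0 * @gint R n (fun=> 0)); last by rewrite mul0r.
  by rewrite -(gintZ 0 b0); congr gint; apply/funext => x /=; rewrite mul0r.
rewrite (_ : (fun x => \sum_(j <- i :: s) F j x) = F i \+ (fun x => \sum_(j <- s) F j x)).
  by split; [exact: bnd_suppD|rewrite gintD// IH big_cons].
by apply/funext => x; rewrite big_cons.
Qed.

Lemma continuous_bnd_supp (R : realType) (n : nat) (f : 'rV[R]_n -> R) (L : R) :
  continuous f -> (forall x, L < `|x| -> f x = 0) -> bnd_supp f.
Proof.
move=> cf f0; have [M M0 fM] := continuous_ball_bounded cf `|L|.
have f0' x : `|L| < `|x| -> f x = 0.
  by move=> h; apply: f0; exact: le_lt_trans (ler_norm _) h.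
exists `|L|, M; split=> // x; have [/fM//|/f0'->] := leP `|x| `|L|.
by rewrite normr0.
Qed.

Lemma bnd_supp_cutoffM (R : realType) (n : nat) (D : set 'rV[R]_n)
    (h phi : 'rV[R]_n -> R) (L : R) :
  (forall x, D x -> {for x, continuous h}) -> continuous phi ->
  (forall x, ~ D x -> \forall y \near x, phi y = 0) ->
  (forall x, L < `|x| -> phi x = 0) -> bnd_supp (h \* phi).
Proof.
move=> ch cphi phi0 phiL.
apply: (@continuous_bnd_supp _ _ _ L); first exact: cutoffM_continuous phi0.
by move=> x /phiL /= ->; rewrite mulr0.
Qed.

(** Green's formula: [f (d i phi) - phi (d i f)] is the derivative of
    [f (g i phi) - phi (g i f)] along the [i]-th axis. The support condition
    makes both products vanish near the points where [f] is not smooth. *)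
Lemma green (R : realType) (n : nat) (D : set 'rV[R]_n) (f phi : 'rV[R]_n -> R)
    fg fd pg pd (L : R) :
  C2_data D f fg fd -> C2_data setT phi pg pd ->
  (forall x, ~ D x -> \forall y \near x, phi y = 0) ->
  (forall x, L < `|x| -> phi x = 0) ->
  gint (f \* lap pd) = gint (lap fd \* phi).
Proof.
move=> [cf Cf] Cphi phiD phiL; have [cphi Cp] := Cphi.
have pgD i x : ~ D x -> \forall y \near x, pg i y = 0.
  by move=> /phiD/(C2_data_near0 i Cphi)[].
have pdD i x : ~ D x -> \forall y \near x, pd i y = 0.
  by move=> /phiD/(C2_data_near0 i Cphi)[].
have near0 x : L < `|x| -> \forall y \near x, phi y = 0.
  by move=> /near_gt_norm; apply: filterS.
have pgL i x : L < `|x| -> pg i x = 0.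
  by move=> /near0/(C2_data_near0 i Cphi)[/nbhs_singleton].
have pdL i x : L < `|x| -> pd i x = 0.
  by move=> /near0/(C2_data_near0 i Cphi)[_ /nbhs_singleton].
have cphi' : continuous phi by move=> x; exact: cphi.
have cpg i : continuous (pg i) by move=> x; have [] := Cp i x I.
have cpd i : continuous (pd i) by move=> x; have [] := Cp i x I.
have cfd i x : D x -> {for x, continuous (fd i)} by move=> /(Cf i)[].
have b1 i : bnd_supp (f \* pd i).
  exact: bnd_supp_cutoffM cf (cpd i) (pdD i) (pdL i).
have b2 i : bnd_supp (fd i \* phi).
  exact: bnd_supp_cutoffM (cfd i) cphi' phiD phiL.
have -> : f \* lap pd = (fun x => \sum_i (f \* pd i) x).
  by apply/funext => x /=; rewrite /lap mulr_sumr.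
have -> : lap fd \* phi = (fun x => \sum_i (fd i \* phi) x).
  by apply/funext => x /=; rewrite /lap mulr_suml.
rewrite !gint_sum//; apply: eq_bigr => i _.
suff : gint ((f \* pd i) \+ (-1 \*o (fd i \* phi))) = 0.
  rewrite gintD ?gintZ//; last exact: bnd_suppZ.
  by rewrite mulN1r => /eqP; rewrite subr_eq0 => /eqP.
apply: (@gint_partial0 _ _ (f \* pg i \+ (-1) \*o (fg i \* phi)) _ i L).
- move=> x; have [Dx|nDx] := pselect (D x); last first.
    have E : \forall y \near x, 0 = (f \* pg i \+ (-1) \*o (fg i \* phi)) y.
      by apply: filterS2 (phiD x nDx) (pgD i x nDx) => y /= -> ->; rewrite !mulr0 addr0.
    rewrite /= (nbhs_singleton (phiD x nDx)) (nbhs_singleton (pdD i x nDx)) !mulr0 addr0.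
    exact: near_eq_is_derive E (is_derive_cst _ _ _).
  have [f1 f2 _ _] := Cf i x Dx; have [p1 p2 _ _] := Cp i x I.
  have h := is_deriveD (is_deriveM f1 p2) (is_deriveZ (-1) (is_deriveM f2 p1)).
  apply: is_derive_eq h _; rewrite /= /GRing.scale /=; ring.
- have -> : f \* pd i \+ (-1) \*o (fd i \* phi) = (f \* pd i) \+ (fd i \* (-1 \*o phi)).
    by apply/funext => x /=; ring.
  move=> x; apply: continuousD; first exact: (cutoffM_continuous cf (cpd i) (pdD i)).
  apply: (cutoffM_continuous (cfd i)).
    by move=> y; apply: continuousMc; exact: cphi'.
  by move=> y /phiD; apply: filterS => z /= ->; rewrite mulr0.
- by move=> x xL /=; rewrite pgL// phiL// !mulr0 addr0.
- by move=> x xL /=; rewrite pdL// phiL// !mulr0 addr0.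
Qed.

Lemma C2_dataM (R : realType) (n : nat) (D : set 'rV[R]_n) (f h : 'rV[R]_n -> R)
    fg fd hg hd :
  C2_data D f fg fd -> C2_data D h hg hd ->
  C2_data D (f \* h) (fun i => f \* hg i \+ h \* fg i)
    (fun i => f \* hd i \+ h \* fd i \+ 2 \*o (fg i \* hg i)).
Proof.
move=> [cf Cf] [ch Ch]; split=> [x Dx|i x Dx]; first by apply: continuousM; [exact: cf|exact: ch].
have cfx := cf x Dx; have chx := ch x Dx.
have [f1 f2 cf1 cf2] := Cf i x Dx; have [h1 h2 ch1 ch2] := Ch i x Dx.
split.
- exact: is_derive_eq (is_deriveM f1 h1) _.
- apply: is_derive_eq (is_deriveD (is_deriveM f1 h2) (is_deriveM h1 f2)) _.
  by rewrite /= /GRing.scale /=; ring.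
- by apply: continuousD; apply: continuousM.
- by apply: continuousD; [apply: continuousD; apply: continuousM|apply: continuousMc; apply: continuousM].
Qed.

(** * Radial functions and polynomial bumps *)

Lemma is_derive_lineP (R : realType) (V : normedModType R) (F : V -> R) (x e : V) (d : R) :
  is_derive (0 : R) (1 : R) (fun t => F (x + t *: e)) d -> is_derive x e F d.
Proof.
have E : (fun h => h^-1 *: (F (x + (h *: 1 + (0 : R)) *: e) - F (x + (0 : R) *: e))) =
         (fun h => h^-1 *: (F (h *: e + x) - F x)).
  by apply/funext => h; rewrite scaler1 addr0 scale0r addr0 (addrC x).
move=> [dF <-]; apply: DeriveDef; first by move: dF; rewrite /derivable E.
by rewrite /derive E.
Qed.

Lemma is_derive_comp1 (R : realType) (V : normedModType R) (h : R -> R) (q : V -> R)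
    (x e : V) (dq dh : R) :
  is_derive x e q dq -> is_derive (q x) 1 h dh -> is_derive x e (h \o q) (dh * dq).
Proof.
move=> qx hq; apply: is_derive_lineP.
have qx0 : is_derive (0 : R) (1 : R) (fun t => q (x + t *: e)) dq.
  by apply: is_derive_line; rewrite scale0r addr0.
by apply: (@is_derive1_comp _ h); rewrite scale0r addr0.
Qed.

Definition sqdist (R : realType) (n : nat) (c x : 'rV[R]_n) : R :=
  \sum_(i < n) (x 0 i - c 0 i) ^+ 2.

Lemma sqdist_ge0 (R : realType) (n : nat) (c x : 'rV[R]_n) : 0 <= sqdist c x.
Proof. by apply: sumr_ge0 => i _; exact: sqr_ge0. Qed.

Lemma coord_sqdist_le (R : realType) (n : nat) (c x : 'rV[R]_n) (i : 'I_n) :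
  (x 0 i - c 0 i) ^+ 2 <= sqdist c x.
Proof.
by rewrite /sqdist (bigD1 i)//= lerDl sumr_ge0// => j _; exact: sqr_ge0.
Qed.

Lemma norm_le_sqdist (R : realType) (n : nat) (c x : 'rV[R]_n) :
  `|x - c| <= Num.sqrt (sqdist c x).
Proof.
apply/row_norm_leP; first exact: sqrtr_ge0.
move=> i; rewrite !mxE -(ler_pXn2r (n := 2)) ?nnegrE ?sqrtr_ge0//.
by rewrite sqr_sqrtr ?sqdist_ge0// real_normK ?num_real// coord_sqdist_le.
Qed.

Lemma sqdist_le2 (R : realType) (n : nat) (c x y : 'rV[R]_n) :
  sqdist y x <= 2 * sqdist c x + 2 * sqdist y c.
Proof.
rewrite /sqdist !mulr_sumr -big_split; apply: ler_sum => i _ /=.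
have := sqr_ge0 (x 0 i - 2 * c 0 i + y 0 i); nra.
Qed.

Lemma sqdist_continuous (R : realType) (n : nat) (c : 'rV[R]_n) : continuous (sqdist c).
Proof.
rewrite /sqdist; apply: continuous_big => [|i _ x]; first exact: add_continuous.
apply: (@continuous_comp _ _ _ (fun x : 'rV[R]_n => x 0 i - c 0 i) (fun y => y ^+ 2)).
  by apply: continuousB; [exact: coord_continuous|exact: cst_continuous].
exact: exprn_continuous.
Qed.

Lemma is_derive_sqdist (R : realType) (n : nat) (c x : 'rV[R]_n) (i : 'I_n) :
  is_derive x (delta_mx 0 i) (sqdist c) (2 * (x 0 i - c 0 i)).
Proof.
apply: is_derive_lineP.
have -> : (fun t => sqdist c (x + t *: delta_mx 0 i)) =
    (fun t => sqdist c x + t * (2 * (x 0 i - c 0 i)) + t ^+ 2).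
  apply/funext => t; rewrite /sqdist (bigD1 i)//= [in RHS](bigD1 i)//= !mxE !eqxx.
  rewrite (eq_bigr (fun j => (x 0 j - c 0 j) ^+ 2)) /=; first by ring.
  by move=> j /negbTE ji; rewrite !mxE eqxx ji mulr0 addr0.
by apply: is_derive_eq; rewrite /GRing.scale /=; ring.
Qed.

Lemma is_derive_coord (R : realType) (n : nat) (a : R) (x : 'rV[R]_n) (i : 'I_n) :
  is_derive x (delta_mx 0 i) (fun x : 'rV[R]_n => x 0 i - a) 1.
Proof.
apply: is_derive_lineP.
have -> : (fun t : R => (x + t *: delta_mx 0 i) 0 i - a) = (fun t => (x 0 i - a) + t).
  by apply/funext => t; rewrite !mxE !eqxx mulr1 addrAC.
have := is_deriveD (is_derive_cst (x 0 i - a) (0 : R) (1 : R)) (is_derive_id (0 : R) (1 : R)).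
by rewrite add0r.
Qed.

Lemma C2_data_radial (R : realType) (n : nat) (h h1 h2 : R -> R) (c : 'rV[R]_n) :
  (forall s : R, is_derive s 1 h (h1 s)) -> (forall s : R, is_derive s 1 h1 (h2 s)) ->
  continuous h2 ->
  C2_data setT (fun x => h (sqdist c x))
    (fun i x => 2 * (x 0 i - c 0 i) * h1 (sqdist c x))
    (fun i x => 4 * (x 0 i - c 0 i) ^+ 2 * h2 (sqdist c x) + 2 * h1 (sqdist c x)).
Proof.
move=> dh dh1 ch2.
have ch : continuous h.
  by move=> s; apply/differentiable_continuous/derivable1_diffP; have [] := dh s.
have ch1 : continuous h1.
  by move=> s; apply/differentiable_continuous/derivable1_diffP; have [] := dh1 s.
have cs := @sqdist_continuous R n c.
have cc (i : 'I_n) : continuous (fun x : 'rV[R]_n => x 0 i - c 0 i).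
  by move=> x; apply: continuousB; [exact: coord_continuous|exact: cst_continuous].
have csh (k : R -> R) : continuous k -> continuous (fun x => k (sqdist c x)).
  by move=> ck x; apply: (@continuous_comp _ _ _ (sqdist c) k); [exact: cs|exact: ck].
split=> [x _|i x _]; first exact: csh.
split.
- apply: is_derive_eq (is_derive_comp1 (is_derive_sqdist c x i) (dh _)) _; ring.
- have D1 := is_derive_comp1 (is_derive_sqdist c x i) (dh1 _).
  have := is_deriveM (is_deriveZ 2 (is_derive_coord (c 0 i) x i)) D1.
  by move/is_derive_eq; apply; rewrite /= /GRing.scale /=; ring.
- by apply: continuousM; [apply: continuousM; [exact: cst_continuous|exact: cc]|exact: csh].
- apply: continuousD; last by apply: continuousM; [exact: cst_continuous|exact: csh].
  apply: continuousM; last exact: csh.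
  apply: continuousM; first exact: cst_continuous.
  apply: (@continuous_comp _ _ _ (fun x : 'rV[R]_n => x 0 i - c 0 i) (fun y => y ^+ 2)).
    exact: cc.
  exact: exprn_continuous.
Qed.

Definition pospow (R : realType) (k : nat) (y : R) : R := Num.max y 0 ^+ k.

Lemma pospow_continuous (R : realType) (k : nat) : continuous (@pospow R k).
Proof.
move=> y; apply: (@continuous_comp _ _ _ (fun y : R => Num.max y 0) (fun z => z ^+ k)).
  by apply: continuous_max => //; exact: cst_continuous.
exact: exprn_continuous.
Qed.

Lemma pospow_ge0 (R : realType) (k : nat) (y : R) : 0 <= pospow k y.
Proof. by rewrite exprn_ge0// le_max lexx orbT. Qed.

Lemma pospow_neg (R : realType) (k : nat) (y : R) : y <= 0 -> pospow k.+1 y = 0.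
Proof. by move=> y0; rewrite /pospow max_r// expr0n. Qed.

Lemma pospow_pos (R : realType) (k : nat) (y : R) : 0 <= y -> pospow k y = y ^+ k.
Proof. by move=> y0; rewrite /pospow max_l. Qed.

Lemma pospowS (R : realType) (k : nat) (y : R) : y * pospow k.+1 y = pospow k.+2 y.
Proof.
have [y0|/ltW y0] := leP y 0; first by rewrite !pospow_neg// mulr0.
by rewrite !pospow_pos// [in RHS]exprS.
Qed.

Lemma is_derive_pospow (R : realType) (k : nat) (y : R) :
  is_derive y 1 (@pospow R k.+2) (k.+2%:R * pospow k.+1 y).
Proof.
have [y0|y0|->] := ltgtP y 0.
- rewrite pospow_neg ?mulr0 ?ltW//.
  apply: near_eq_is_derive (is_derive_cst 0 y 1).
  by apply: filterS (lt_nbhsl y0) => z z0; rewrite pospow_neg// ltW.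
- rewrite pospow_pos ?ltW//.
  have E : \forall z \near y, z ^+ k.+2 = pospow k.+2 z.
    by apply: filterS (lt_nbhsr y0) => z z0; rewrite pospow_pos// ltW.
  apply: near_eq_is_derive E _.
  by apply: DeriveDef; [exact: exprn_derivable|rewrite exp_derive scaler1].
- rewrite pospow_neg// mulr0; apply/is_derive1_caratheodory; exists (pospow k.+1); split.
  + by move=> z; rewrite (pospow_neg _ (lexx 0)) !subr0 -pospowS mulrC.
  + exact: pospow_continuous.
  + by rewrite pospow_neg.
Qed.

(** The weights of all the means below. For [k >= 1] the bump is supported in the
    Euclidean ball of radius [r]; it has two continuous derivatives for
    [k >= 3]; and its mass concentrates at [c] as [k] grows. *)
Definition pbump (R : realType) (n : nat) (c : 'rV[R]_n) (r : R) (k : nat)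
    (x : 'rV[R]_n) : R := pospow k (1 - sqdist c x / r ^+ 2).

Lemma bump_ge0 (R : realType) (n : nat) (c : 'rV[R]_n) r k x : 0 <= pbump c r k x.
Proof. exact: pospow_ge0. Qed.

Lemma bump_base_le1 (R : realType) (n : nat) (c : 'rV[R]_n) (r : R) x :
  1 - sqdist c x / r ^+ 2 <= 1.
Proof. by rewrite gerBl divr_ge0 ?sqdist_ge0 ?sqr_ge0. Qed.

Lemma bump_le (R : realType) (n : nat) (c : 'rV[R]_n) r k l x : (k <= l)%N ->
  pbump c r l x <= pbump c r k x.
Proof.
move=> kl; rewrite /pbump /pospow; apply: ler_wiXn2l => //.
  by rewrite le_max lexx orbT.
by rewrite ge_max ler01 bump_base_le1.
Qed.

Lemma bump_continuous (R : realType) (n : nat) (c : 'rV[R]_n) r k :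
  continuous (pbump c r k).
Proof.
move=> x; apply: (@continuous_comp _ _ _ (fun x => 1 - sqdist c x / r ^+ 2)).
  apply: continuousB; first exact: cst_continuous.
  by apply: continuousM; [exact: sqdist_continuous|exact: cst_continuous].
exact: pospow_continuous.
Qed.

Lemma bump_eq0 (R : realType) (n : nat) (c : 'rV[R]_n) (r : R) k x : 0 < r ->
  r ^+ 2 <= sqdist c x -> pbump c r k.+1 x = 0.
Proof.
move=> r0 h; rewrite /pbump pospow_neg// subr_le0 ler_pdivlMr ?mul1r//.
exact: exprn_gt0.
Qed.

Lemma sqdist_far (R : realType) (n : nat) (c : 'rV[R]_n) (r : R) x : 0 < r ->
  `|c| + r < `|x| -> r ^+ 2 <= sqdist c x.
Proof.
move=> r0 cx; have /existsNP[i /negP] : ~ (forall i, `|(x - c) 0 i| <= r).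
  move/row_norm_leP => /(_ (ltW r0)); apply/negP; rewrite -ltNge.
  have := lerB_normD x (- c); rewrite normrN; apply: lt_le_trans.
  by rewrite ltrBrDl.
rewrite -ltNge !mxE => ri; apply: le_trans (coord_sqdist_le c x i).
rewrite -[leRHS]real_normK ?num_real// lerXn2r ?nnegrE ?(ltW r0)//.
exact: ltW.
Qed.

Lemma bump_supp (R : realType) (n : nat) (c : 'rV[R]_n) (r : R) k x : 0 < r ->
  `|c| + r < `|x| -> pbump c r k.+1 x = 0.
Proof. by move=> r0 h; rewrite bump_eq0// sqdist_far. Qed.

Lemma bnd_supp_bump (R : realType) (n : nat) (c : 'rV[R]_n) (r : R) k : 0 < r ->
  bnd_supp (pbump c r k.+1).
Proof.
move=> r0; apply: (@continuous_bnd_supp _ _ _ (`|c| + r)); first exact: bump_continuous.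
by move=> x; exact: bump_supp.
Qed.

(** The Laplacian maps the span of the bumps with given centre and radius into
    itself, so that no other test function is needed to iterate Green's
    formula. *)
Lemma bump_C2 (R : realType) (n : nat) (c : 'rV[R]_n) (r : R) k : 0 < r ->
  exists g d, C2_data setT (pbump c r k.+3) g d /\ forall x,
    lap d x = r ^- 2 * (4 * k.+3%:R * k.+2%:R * pbump c r k.+1 x
                        - k.+3%:R * (4 * k.+2%:R + 2 * n%:R) * pbump c r k.+2 x).
Proof.
move=> r0; have r20 : r ^+ 2 != 0 by rewrite expf_neq0// lt0r_neq0.
pose b (s : R) := 1 - s / r ^+ 2.
have db (s : R) : is_derive s 1 b (- r ^- 2).
  have -> : b = cst 1 - r ^- 2 \*: id by apply/funext => t; rewrite /b mulrC.
  apply: is_derive_eq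
    (is_deriveB (is_derive_cst (1 : R) s 1) (is_deriveZ (r ^- 2) (is_derive_id s 1))) _.
  by rewrite scaler1 sub0r.
have dp j (s : R) : is_derive s 1 (fun s => pospow j.+2 (b s))
    (j.+2%:R * pospow j.+1 (b s) * - r ^- 2).
  exact: is_derive1_comp (is_derive_pospow j (b s)) (db s).
have := @C2_data_radial R n (fun s => pospow k.+3 (b s))
  (fun s => - (k.+3%:R * r ^- 2) * pospow k.+2 (b s))
  (fun s => k.+3%:R * k.+2%:R * r ^- 4 * pospow k.+1 (b s)) c.
case.
- by move=> s; apply: is_derive_eq (dp k.+1 s) _; ring.
- move=> s; apply: is_derive_eq (is_deriveZ _ (dp k s)) _.
  by rewrite /GRing.scale /=; field; rewrite -?exprM ?expf_neq0 ?lt0r_neq0.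
- move=> s; apply: (@continuousMc _ _ _ (fun s => pospow k.+1 (b s))).
  apply: (@continuous_comp _ _ _ b); last exact: pospow_continuous.
  by apply/differentiable_continuous/derivable1_diffP; have [] := db s.
move=> c1 c2; do 2 eexists; split; first exact: (conj c1 c2).
move=> x; rewrite /lap big_split /= sumr_const card_ord -mulr_suml -mulr_sumr.
rewrite -/(sqdist c x) -/(b _) /pbump -/(b _).
have -> : sqdist c x = r ^+ 2 * (1 - b (sqdist c x)).
  by rewrite /b opprB addrC subrK mulrC divfK.
set y := b _; have -> : b (r ^+ 2 * (1 - y)) = y.
  by rewrite /b; field; rewrite lt0r_neq0.
rewrite -mulr_natr -(pospowS k y); field.
by rewrite lt0r_neq0.
Qed.

(** * Superharmonic functions and the mean value inequality *)

Lemma ball_bounded_cst (R : realType) (n : nat) (a : R) : @ball_bounded R n (fun=> a).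
Proof. by move=> L; exists `|a|. Qed.

Lemma C2_data_cst (R : realType) (n : nat) (D : set 'rV[R]_n) (a : R) :
  C2_data D (fun=> a) (fun _ _ => 0) (fun _ _ => 0).
Proof.
by split=> [x _|i x _]; [exact: cst_continuous|split;
  [exact: is_derive_cst|exact: is_derive_cst|exact: cst_continuous|exact: cst_continuous]].
Qed.

Lemma gint_lap_bump (R : realType) (n : nat) (c : 'rV[R]_n) (r : R) k : 0 < r ->
  exists g d, C2_data setT (pbump c r k.+3) g d /\ forall w, ball_bounded w ->
    gint (w \* lap d) =
    r ^- 2 * (4 * k.+3%:R * k.+2%:R * gint (w \* pbump c r k.+1)
              - k.+3%:R * (4 * k.+2%:R + 2 * n%:R) * gint (w \* pbump c r k.+2)).
Proof.
move=> r0; have [g [d [C E]]] := bump_C2 c k r0; exists g, d; split=> // w bw.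
have b1 : bnd_supp (w \* pbump c r k.+1) by apply: bnd_suppM; [|exact: bnd_supp_bump].
have b2 : bnd_supp (w \* pbump c r k.+2) by apply: bnd_suppM; [|exact: bnd_supp_bump].
set A := 4 * _ * _; set B := k.+3%:R * _.
have -> : w \* lap d = r ^- 2 \*o (A \*o (w \* pbump c r k.+1) \+ - B \*o (w \* pbump c r k.+2)).
  by apply/funext => x /=; rewrite E -/A -/B; ring.
by rewrite gintZ ?gintD ?gintZ ?mulNr//; do ?[exact: bnd_suppZ|apply: bnd_suppD].
Qed.

Lemma gint_ge0 (R : realType) (n : nat) (f : 'rV[R]_n -> R) :
  bnd_supp f -> (forall x, 0 <= f x) -> 0 <= gint f.
Proof. by move=> bf f0; apply: gint_unit_box. Qed.

(** Green's formula for the constant function 1, whose Laplacian is 0. It compares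
    the masses of bumps with different exponents, uniformly in [c] and [r]. *)
Lemma bump_moment_rec (R : realType) (n : nat) (c : 'rV[R]_n) (r : R) k : 0 < r ->
  4 * k.+2%:R * gint (pbump c r k.+1) = (4 * k.+2%:R + 2 * n%:R) * gint (pbump c r k.+2).
Proof.
move=> r0; have [g [d [C E]]] := gint_lap_bump c k r0.
have := green (C2_data_cst setT 1) C (fun x nT => False_ind _ (nT I))
  (fun x => bump_supp k.+2 r0).
rewrite E; last exact: ball_bounded_cst.
have one1 (f : 'rV[R]_n -> R) : (fun=> 1) \* f = f by apply/funext => x /=; rewrite mul1r.
have -> : lap (fun _ _ => 0) \* pbump c r k.+3 = 0 \*o pbump c r k.+3.
  by apply/funext => x /=; rewrite /lap big1.
rewrite gintZ; last exact: bnd_supp_bump.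
rewrite !one1 mul0r => /eqP; rewrite mulf_eq0 invr_eq0 sqrf_eq0 gt_eqF//=.
rewrite subr_eq0 -mulrA [4 * _]mulrC -!mulrA (inj_eq (mulfI _)) ?pnatr_eq0// => /eqP.
by rewrite mulrA.
Qed.

(** Superharmonicity in the sense of distributions, the form that survives at a
    point where [w] is merely continuous. *)
Definition weakly_superharmonic (R : realType) (n : nat) (w : 'rV[R]_n -> R) : Prop :=
  forall phi g d L, C2_data setT phi g d -> (forall x, 0 <= phi x) ->
    (forall x, L < `|x| -> phi x = 0) -> gint (w \* lap d) <= 0.

(** Together with the equality [bump_moment_rec], this says that the mean of [w]
    against the bump of exponent [k] is nondecreasing in [k]. *)
Lemma superharmonic_moment_rec (R : realType) (n : nat) (w : 'rV[R]_n -> R)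
    (c : 'rV[R]_n) (r : R) k :
  continuous w -> weakly_superharmonic w -> 0 < r ->
  4 * k.+2%:R * gint (w \* pbump c r k.+1)
    <= (4 * k.+2%:R + 2 * n%:R) * gint (w \* pbump c r k.+2).
Proof.
move=> cw sw r0; have [g [d [C E]]] := gint_lap_bump c k r0.
have := sw _ _ _ _ C (fun x => bump_ge0 _ _ _ _) (fun x => bump_supp k.+2 r0).
rewrite E; last exact: continuous_ball_bounded.
rewrite pmulr_rle0; last by rewrite invr_gt0 exprn_gt0.
rewrite subr_le0.
rewrite -[X in X <= _]mulrA [4 * _]mulrC -!mulrA ler_pM2l ?ltr0n//.
Qed.

(** Once positive, [e] stays so with consecutive ratios at least [1 - O(1/k)]; its
    decay is then at most polynomial, which no geometric bound allows. *)
Lemma not_geometric_decay (R : realType) (n : nat) (e : nat -> R) (B tau : R) :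
  (forall k, 4 * k.+2%:R * e k <= (4 * k.+2%:R + 2 * n%:R) * e k.+1) ->
  (forall k, e k <= B * tau ^+ k) -> 0 <= tau -> tau < 1 -> forall k, e k <= 0.
Proof.
move=> rec eB tau0 tau1 k0; rewrite leNgt; apply/negP => ek0.
have pos k : 0 < e (k0 + k)%N.
  elim: k => [|k IH]; first by rewrite addn0.
  rewrite addnS; have := rec (k0 + k)%N; set x := 4 * _ => h.
  have x0 : 0 < x by rewrite mulr_gt0// ltr0n.
  have : 0 < (x + 2 * n%:R) * e (k0 + k).+1 by apply: lt_le_trans h; rewrite mulr_gt0.
  by rewrite pmulr_rgt0// ltr_wpDr// mulr_ge0.
(* Any ratio strictly between [tau] and 1 would do. *)
pose s := (1 + tau) / 2.
have s0 : 0 < s by rewrite /s; lra.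
have s1 : s < 1 by rewrite /s; lra.
have ts : tau < s by rewrite /s; lra.
pose K := (k0 + Num.truncn (2 * n%:R * s / (1 - s)))%N.
have ratio k : s * e (K + k)%N <= e (K + k).+1.
  have := rec (K + k)%N; set x := 4 * _ => h.
  have x0 : 0 < x by rewrite mulr_gt0// ltr0n.
  have xn : 2 * n%:R * s <= x * (1 - s).
    rewrite -ler_pdivrMr ?subr_gt0//.
    apply: (@le_trans _ _ (K + k).+2%:R); last by rewrite /x ler_peMl// ler1n.
    apply/ltW; apply: lt_le_trans (truncnS_gt _) _; rewrite ler_nat ltnS /K.
    by rewrite -addnS addnAC leq_addl.
  have e1 : 0 <= e (K + k)%N by rewrite /K -addnA ltW.
  have xn0 : 0 < x + 2 * n%:R by rewrite ltr_wpDr// mulr_ge0.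
  rewrite -(ler_pM2l xn0); apply: le_trans h; rewrite mulrA ler_wpM2r//.
  by rewrite mulrDl; lra.
have low k : s ^+ k * e K <= e (K + k)%N.
  elim: k => [|k IH]; first by rewrite mul1r addn0.
  rewrite addnS exprS -mulrA; apply: le_trans (ratio k).
  by rewrite ler_wpM2l// ltW.
have eK : 0 < e K by rewrite /K.
have dom k : e K <= B * tau ^+ K * (tau / s) ^+ k.
  have := le_trans (low k) (eB (K + k)%N).
  rewrite exprD mulrA (expr_div_n tau s) => h.
  by rewrite mulrA ler_pdivlMr ?exprn_gt0// mulrC.
have : (fun k => B * tau ^+ K * (tau / s) ^+ k) @ \oo --> B * tau ^+ K * 0.
  apply: cvgMr; apply: cvg_expr.
  have q0 : 0 <= tau / s by rewrite divr_ge0// ltW.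
  have q1 : tau / s < 1 by rewrite ltr_pdivrMr// mul1r.
  by rewrite (ger0_norm q0).
rewrite mulr0 => h; suff : e K <= 0 by rewrite leNgt eK.
by apply: (ler_cvg_to (f := fun=> e K) (cvg_cst _) h); exact: nearW.
Qed.

(** Instead of letting the radius shrink, let the exponent grow: by the
    superharmonic recursion the normalised moments of [w] against [pbump c r k]
    increase with [k], and the bumps concentrate at [c], so that [w c] is the
    limit. *)
Lemma superharmonic_mean_le (R : realType) (n : nat) (w : 'rV[R]_n -> R)
    (c : 'rV[R]_n) (r : R) k :
  continuous w -> weakly_superharmonic w -> 0 < r ->
  gint (w \* pbump c r k.+1) <= w c * gint (pbump c r k.+1).
Proof.
move=> cw sw r0.
have b0 : 0 <= gint (pbump c r k.+1).
  by apply: gint_ge0; [exact: bnd_supp_bump|move=> x; exact: bump_ge0].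
(* Proving the bound for every [v > w c] leaves room: [w - v] is negative on a whole
   neighbourhood of [c]. *)
suff above v : w c < v -> gint (w \* pbump c r k.+1) <= v * gint (pbump c r k.+1).
  apply/ler_addgt0Pr => e e0.
  have b1 : 0 < gint (pbump c r k.+1) + 1 by rewrite ltr_wpDl.
  apply: le_trans (above (w c + e / (gint (pbump c r k.+1) + 1)) _) _.
    by rewrite ltrDl divr_gt0.
  rewrite mulrDl lerD2l -mulrA ger_pMr// mulrC ler_pdivrMr// mul1r lerDl//.
move=> wv; pose e j := gint (w \* pbump c r j.+1) - v * gint (pbump c r j.+1).
suff : e k <= 0 by rewrite /e subr_le0.
have cwv : continuous (fun x => w x - v).
  by move=> x; apply: continuousB; [exact: cw|exact: cst_continuous].
have eE j : e j = gint ((fun x => w x - v) \* pbump c r j.+1).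
  have -> : (fun x => w x - v) \* pbump c r j.+1 =
            w \* pbump c r j.+1 \+ (- v) \*o pbump c r j.+1.
    by apply/funext => x /=; rewrite mulrBl mulNr.
  have bb := bnd_supp_bump c j r0.
  rewrite gintD ?gintZ ?mulNr//; last exact: bnd_suppZ.
  by apply: bnd_suppM => //; exact: continuous_ball_bounded.
have [M M0 wM] := continuous_ball_bounded cwv (`|c| + r).
have [d d0 wd] : exists2 d, 0 < d & forall x, `|x - c| < d -> w x < v.
  have : \forall x \near c, w x < v by exact: cvgr_lt (cw c) _ wv.
  move=> /nbhs_ballP[d /= d0 h]; exists d => // x xc.
  by apply: h; rewrite -ball_normE /= distrC.
(* Outside the ball of radius [d] the base of the bump is at most [tau], so the part
   of [e j] that is not negative decays geometrically. *)
pose tau : R := Num.max 0 (1 - d ^+ 2 / r ^+ 2).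
have tau0 : 0 <= tau by rewrite le_max lexx.
apply: (@not_geometric_decay _ n _ (M * gint (pbump c r 1)) tau).
- move=> j; rewrite /e !mulrBr lerB//; first exact: superharmonic_moment_rec.
  by rewrite mulrCA -bump_moment_rec// mulrCA.
- move=> j; rewrite eE -mulrA [_ * tau ^+ _]mulrC mulrA -gintZ; last exact: bnd_supp_bump.
  apply: le_gint.
  + by apply: bnd_suppM; [exact: continuous_ball_bounded|exact: bnd_supp_bump].
  + by apply: bnd_suppZ; exact: bnd_supp_bump.
  move=> x /=; have tj : 0 <= tau ^+ j by exact: exprn_ge0.
  have [|xr] := leP `|x| (`|c| + r); last by rewrite !bump_supp// !mulr0.
  move=> /wM wMx; have [xd|dx] := ltP `|x - c| d.
    apply: (@le_trans _ _ 0); last by rewrite !mulr_ge0// bump_ge0.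
    by rewrite mulr_le0_ge0 ?bump_ge0// subr_le0 ltW// wd.
  apply: (@le_trans _ _ (M * pbump c r j.+1 x)).
    by rewrite ler_wpM2r ?bump_ge0// (le_trans (ler_norm _)).
  rewrite -mulrA ler_wpM2l// /pbump /pospow exprSr expr1 ler_wpM2r ?le_max ?lexx ?orbT//.
  have m0 : 0 <= Num.max (1 - sqdist c x / r ^+ 2) 0 by rewrite le_max lexx orbT.
  rewrite lerXn2r ?nnegrE// ge_max tau0 andbT le_max; apply/orP; right.
  rewrite lerB// ler_pM2r ?invr_gt0 ?exprn_gt0//.
  rewrite leNgt; apply/negP => h; move: dx; rewrite leNgt => /negP; apply.
  apply: le_lt_trans (norm_le_sqdist c x) _.
  by rewrite -(ltr_pXn2r (n := 2)) ?nnegrE ?sqrtr_ge0 ?(ltW d0)// sqr_sqrtr ?sqdist_ge0.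
- by [].
- by rewrite gt_max ltr01 ltrBlDr ltrDl divr_gt0 ?exprn_gt0.
Qed.

(** * Removing the origin *)

Lemma pospow_le1 (R : realType) (k : nat) (y : R) : y <= 1 -> pospow k y <= 1.
Proof.
by move=> y1; rewrite exprn_ile1// ?le_max ?lexx ?orbT// ge_max y1 ler01.
Qed.

(** The cutoff is [1 - (1 - ((s - 1)_+)^3)_+ ^ 3] with [s = |x|^2 / e^2]: the cubes
    give two continuous derivatives, it is 0 for [s <= 1] and 1 for [s >= 2]. The
    derivatives of order [j] have size [e ^- j] by scaling; the constants 36 and
    600 are crude. *)
Lemma origin_cutoff (R : realType) (n : nat) (e : R) : 0 < e ->
  exists zeta g d, [/\ @C2_data R n setT zeta g d,
    \forall x \near (0 : 'rV[R]_n), zeta x = 0,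
    forall x, 0 <= zeta x <= 1,
    forall x, 2 * e < `|x| -> zeta x = 1 /\ forall i, g i x = 0 /\ d i x = 0
    & forall i x, `|g i x| <= 36 / e /\ `|d i x| <= 600 / e ^+ 2].
Proof.
move=> e0; have e2 : 0 < e ^+ 2 by exact: exprn_gt0.
pose E := e ^- 2; have E0 : 0 < E by rewrite invr_gt0.
pose b (s : R) := s * E - 1.
have db (s : R) : is_derive s 1 b E.
  have -> : b = E \*: id - cst 1 by apply/funext => t; rewrite /b mulrC.
  apply: is_derive_eq
    (is_deriveB (is_deriveZ E (is_derive_id s (1 : R))) (is_derive_cst (1 : R) s 1)) _.
  by rewrite scaler1 subr0.
pose v (s : R) := 1 - pospow 3 (b s).
have dpb j (s : R) : is_derive s 1 (fun s => pospow j.+2 (b s))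
    (j.+2%:R * pospow j.+1 (b s) * E).
  exact: is_derive1_comp (is_derive_pospow j (b s)) (db s).
have dv (s : R) : is_derive s 1 v (- (3 * pospow 2 (b s) * E)).
  have -> : v = cst 1 - (fun s => pospow 3 (b s)) by [].
  apply: is_derive_eq (is_deriveB (is_derive_cst (1 : R) s 1) (dpb 1 s)) _.
  by rewrite sub0r.
have dpv j (s : R) : is_derive s 1 (fun s => pospow j.+2 (v s))
    (j.+2%:R * pospow j.+1 (v s) * - (3 * pospow 2 (b s) * E)).
  exact: is_derive1_comp (is_derive_pospow j (v s)) (dv s).
pose h (s : R) := 1 - pospow 3 (v s).
pose h1 (s : R) := 9 * E * (pospow 2 (v s) * pospow 2 (b s)).
pose h2 (s : R) := 9 * E * (pospow 2 (v s) * (2 * pospow 1 (b s) * E)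
   + pospow 2 (b s) * (2 * pospow 1 (v s) * - (3 * pospow 2 (b s) * E))).
have cb : continuous b.
  by move=> s; apply/differentiable_continuous/derivable1_diffP; have [] := db s.
have cv : continuous v.
  by move=> s; apply/differentiable_continuous/derivable1_diffP; have [] := dv s.
have cpb j : continuous (fun s => pospow j (b s)).
  by move=> s; apply: (@continuous_comp _ _ _ b); [exact: cb|exact: pospow_continuous].
have cpv j : continuous (fun s => pospow j (v s)).
  by move=> s; apply: (@continuous_comp _ _ _ v); [exact: cv|exact: pospow_continuous].
have C : @C2_data R n setT (fun x => h (sqdist 0 x))
    (fun i x => 2 * (x 0 i - (0 : 'rV[R]_n) 0 i) * h1 (sqdist 0 x))
    (fun i x => 4 * (x 0 i - (0 : 'rV[R]_n) 0 i) ^+ 2 * h2 (sqdist 0 x) + 2 * h1 (sqdist 0 x)).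
  apply: C2_data_radial.
  - move=> s; have -> : h = cst 1 - (fun s => pospow 3 (v s)) by [].
    apply: is_derive_eq (is_deriveB (is_derive_cst (1 : R) s 1) (dpv 1 s)) _.
    by rewrite /h1; ring.
  - move=> s; apply: is_derive_eq (is_deriveZ (9 * E) (is_deriveM (dpv 0 s) (dpb 0 s))) _.
    by rewrite /h2 /GRing.scale /=; ring.
  - pose pv j s := pospow j (v s); pose pb j s := pospow j (b s).
    have -> : h2 = (9 * E * 2 * E) \*o (pv 2 \* pb 1) \+
        (- (54 * E ^+ 2)) \*o (pb 2 \* (pv 1 \* pb 2)).
      by apply/funext => s; rewrite /h2 /pv /pb /=; ring.
    move=> s; apply: continuousD; apply: continuousMc.
      by apply: continuousM; [exact: cpv|exact: cpb].
    by apply: continuousM; [exact: cpb|apply: continuousM; [exact: cpv|exact: cpb]].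
have v1 s : v s <= 1 by rewrite gerBl pospow_ge0.
have small s : s <= e ^+ 2 -> h s = 0.
  move=> se; rewrite /h /v (@pospow_neg _ 2 (b s)).
    by rewrite subr0 pospow_pos// expr1n subrr.
  by rewrite subr_le0 ler_pdivrMr// mul1r.
have large s : 2 * e ^+ 2 <= s -> v s <= 0.
  move=> se; have b1 : 1 <= b s.
    by rewrite lerBrDr -[1 + 1]/(2 : R) ler_pdivlMr.
  rewrite subr_le0 pospow_pos ?exprn_ege1//.
  exact: le_trans b1.
have largeh s : 2 * e ^+ 2 <= s -> [/\ h s = 1, h1 s = 0 & h2 s = 0].
  move=> /large vs; rewrite /h /h1 /h2 !(pospow_neg _ vs) subr0 mul0r mulr0; split=> //.
  by rewrite !(mulr0, mul0r, addr0).
have bnd s : s <= 2 * e ^+ 2 -> `|h1 s| <= 9 * E /\ `|h2 s| <= 72 * E ^+ 2.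
  move=> se; have b1 : b s <= 1.
    by rewrite lerBlDr -[1 + 1]/(2 : R) ler_pdivrMr.
  have := (pospow_ge0 1 (b s), pospow_le1 1 b1).
  have := (pospow_ge0 2 (b s), pospow_le1 2 b1).
  have := (pospow_ge0 1 (v s), pospow_le1 1 (v1 s)).
  have := (pospow_ge0 2 (v s), pospow_le1 2 (v1 s)).
  rewrite /h1 /h2.
  move: (pospow 1 (b s)) (pospow 2 (b s)) (pospow 1 (v s)) (pospow 2 (v s)).
  move=> p1 p2 q1 q2 [q20 q21] [q10 q11] [p20 p21] [p10 p11].
  have a1 : 0 <= q2 * p2 <= 1 by rewrite mulr_ge0//= mulr_ile1.
  have a2 : 0 <= q2 * p1 <= 1 by rewrite mulr_ge0//= mulr_ile1.
  have a3 : 0 <= p2 * (q1 * p2) <= 1.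
    by rewrite !mulr_ge0//= mulr_ile1 ?mulr_ge0// mulr_ile1.
  split.
    by case/andP: a1 => ? ?; rewrite ger0_norm ?mulr_ge0 ?(ltW E0)// ger_pMr ?mulr_gt0.
  have -> : 9 * E * (q2 * (2 * p1 * E) + p2 * (2 * q1 * - (3 * p2 * E))) =
            (18 * (q2 * p1) - 54 * (p2 * (q1 * p2))) * E ^+ 2 by ring.
  rewrite normrM [X in _ * X]ger0_norm ?sqr_ge0// ler_wpM2r ?sqr_ge0//.
  case/andP: a2 => ? ?; case/andP: a3 => ? ?.
  by rewrite ler_norml; apply/andP; split; lra.
do 3 eexists; split; first exact: C.
- have s0 : sqdist 0 (0 : 'rV[R]_n) < e ^+ 2.
    by rewrite /sqdist big1// => i _; rewrite !mxE subrr expr0n.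
  have H : \forall x \near (0 : 'rV[R]_n), sqdist 0 x < e ^+ 2.
    exact: cvgr_lt (@sqdist_continuous R n 0 0) _ s0.
  by apply: filterS H => x /ltW; exact: small.
- move=> x; rewrite /h subr_ge0 gerBl pospow_ge0 andbT.
  exact: pospow_le1.
- move=> x x2; have /largeh[H H1 H2] : 2 * e ^+ 2 <= sqdist 0 x.
    apply: le_trans (@sqdist_far _ _ 0 (2 * e) x _ _) => //.
    + by rewrite exprMn ler_pM2r// -natrX ler_nat.
    + by rewrite mulr_gt0.
    + by rewrite normr0 add0r.
  by split=> // i; rewrite H1 H2 !mulr0 addr0.
- move=> i x; have [|xl] := leP (sqdist 0 x) (2 * e ^+ 2); last first.
    have [_ -> ->] := largeh _ (ltW xl).
    by rewrite !mulr0 addr0 normr0 !divr_ge0// ltW.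
  move=> xs; have [H1 H2] := bnd _ xs.
  have xi := coord_sqdist_le 0 x i; move: xi; set y := x 0 i - _ => yi.
  have y2 : y ^+ 2 <= 2 * e ^+ 2 by exact: le_trans xs.
  have ya : `|y| <= 2 * e.
    rewrite -(ler_pXn2r (n := 2)) ?nnegrE ?mulr_ge0 ?(ltW e0)//.
    rewrite real_normK ?num_real// (le_trans y2)// exprMn ler_pM2r// -natrX ler_nat//.
  move: (h1 _) (h2 _) H1 H2 => k1 k2 H1 H2; split.
    have -> : 36 / e = 2 * (2 * e) * (9 * E).
      by rewrite /E; field; rewrite lt0r_neq0.
    rewrite 2!normrM (@ger0_norm _ 2)// ler_pM// ?mulr_ge0//.
    by rewrite ler_pM2l.
  apply: (@le_trans _ _ (4 * (2 * e ^+ 2) * (72 * E ^+ 2) + 2 * (9 * E))).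
    rewrite (le_trans (ler_normD _ _))// lerD//.
      rewrite 2!normrM (@ger0_norm _ 4)// (@ger0_norm _ (y ^+ 2)) ?sqr_ge0//.
      by apply: ler_pM => //; [rewrite mulr_ge0 ?sqr_ge0|rewrite ler_pM2l].
    by rewrite normrM (@ger0_norm _ 2)// ler_pM2l.
  have -> : 4 * (2 * e ^+ 2) * (72 * E ^+ 2) + 2 * (9 * E) = 594 / e ^+ 2.
    by rewrite /E; field; rewrite lt0r_neq0.
  by rewrite ler_pM2r ?invr_gt0// ler_nat.
Qed.

Lemma lap_continuous (R : realType) (n : nat) (D : set 'rV[R]_n) (f : 'rV[R]_n -> R)
    g d x : C2_data D f g d -> D x -> {for x, continuous (lap d)}.
Proof.
move=> [_ C] Dx; suff aux (s : seq 'I_n) : {for x, continuous (fun y => \sum_(i <- s) d i y)} by exact: aux.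
elim: s => [|i s IH].
  rewrite (_ : (fun y => _) = fun=> 0); first exact: cst_continuous.
  by apply/funext => y; rewrite big_nil.
rewrite (_ : (fun y => _) = d i \+ (fun y => \sum_(i <- s) d i y)); last first.
  by apply/funext => y; rewrite big_cons.
by apply: continuousD => //; have [] := C i x Dx.
Qed.

(** An isolated point is removable for superharmonicity: the cutoff error lives
    in a ball of radius [2 e], of volume [O(e ^ n)], and its size is
    [O(e ^ -2)], so that it disappears as soon as [n >= 3]. The indicator of
    [1 <= `|x|] keeps the left-hand side clear of the singularity. *)
Lemma green_punctured (R : realType) (n : nat) (w : 'rV[R]_n -> R) wg wd phi pg pd L :
  (3 <= n)%N -> continuous w ->
  C2_data [set x | x != 0] w wg wd -> (forall x, x != 0 -> lap wd x <= 0) ->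
  C2_data setT phi pg pd -> (forall x, 0 <= phi x) -> (forall x, L < `|x| -> phi x = 0) ->
  let m := (fun x => if 1 <= `|x| then - lap wd x else 0) \* phi in
  bnd_supp m /\ gint m <= - gint (w \* lap pd).
Proof.
move=> n3 cw Cw wd0 Cp phi0 phiL m.
have cphi : continuous phi by move=> x; exact: Cp.1.
have clap x : x != 0 -> {for x, continuous (lap wd)} by exact: lap_continuous Cw.
have cpd i : continuous (pd i) by move=> x; have [] := Cp.2 i x I.
have cpg i : continuous (pg i) by move=> x; have [] := Cp.2 i x I.
have near_bound (e : R) : 0 < e -> 2 * e < 1 -> exists zeta g d,
  [/\ C2_data setT zeta g d, forall x, 0 <= zeta x <= 1,
    forall x, 2 * e < `|x| -> zeta x = 1 /\ forall i, g i x = 0 /\ d i x = 0,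
    forall i x, `|g i x| <= 36 / e /\ `|d i x| <= 600 / e ^+ 2 &
    bnd_supp m /\ exists pzg pzd, [/\ C2_data setT (phi \* zeta) pzg pzd,
      pzd = (fun i => phi \* d i \+ zeta \* pd i \+ 2 \*o (pg i \* g i)) &
      gint m <= - gint (w \* lap pzd)]].
  move=> e0 e1; have [z [g [d [Cz z0 z01 zfar zd]]]] := origin_cutoff n e0.
  exists z, g, d; split=> //.
  have Cpz := C2_dataM Cp Cz; set pzd := (fun i => _) in Cpz.
  have pz0 x : ~ [set x : 'rV[R]_n | x != 0] x -> \forall y \near x, (phi \* z) y = 0.
    move=> /negP; rewrite negbK => /eqP ->.
    by apply: filterS z0 => y /= ->; rewrite mulr0.
  have pzL x : L < `|x| -> (phi \* z) x = 0 by move=> /phiL /= ->; rewrite mul0r.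
  have cpz : continuous (phi \* z) by move=> x; exact: Cpz.1.
  have bpz := bnd_supp_cutoffM clap cpz pz0 pzL.
  have z00 : z 0 = 0 by exact: nbhs_singleton z0.
  have mE x : 0 <= m x <= (-1 \*o (lap wd \* (phi \* z))) x.
    rewrite /m /= mulN1r -mulNr; have [x1|x1] := leP 1 `|x|.
      have [-> _] := zfar x (lt_le_trans e1 x1); rewrite mulr1 lexx andbT.
      rewrite mulr_ge0// oppr_ge0 wd0//; apply/eqP => x0.
      by move: x1; rewrite x0 normr0 ler10.
    rewrite mul0r lexx /=; have [->|x0] := eqVneq x 0; first by rewrite z00 !mulr0.
    by rewrite !mulr_ge0 ?oppr_ge0 ?wd0//; case/andP: (z01 x).
  have bm : bnd_supp m.
    apply: bnd_supp_dom (bnd_suppZ (-1) bpz) => x.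
    by have /andP[m0 mle] := mE x; rewrite ger0_norm.
  split=> //; do 2 eexists; split; [exact: Cpz|by []|].
  rewrite (green Cw Cpz pz0 pzL) -mulN1r -gintZ//.
  apply: le_gint => //; first exact: bnd_suppZ.
  by move=> x; case/andP: (mE x).
have half : 0 < (4 : R)^-1 /\ 2 * (4 : R)^-1 < 1 by split; lra.
split.
  by have [z [g [d [_ _ _ _ []]]]] := near_bound _ half.1 half.2.
have [Mw Mw0 wM] := continuous_ball_bounded cw 1.
have [Mp Mp0 pM] := continuous_ball_bounded cphi 1.
have /fin_all_exists[Md MdP] : forall i : 'I_n, exists M, 0 <= M /\
    forall x, `|x| <= 1 -> `|pd i x| <= M.
  by move=> i; have [M M0 h] := continuous_ball_bounded (cpd i) 1; exists M.
have /fin_all_exists[Mg MgP] : forall i : 'I_n, exists M, 0 <= M /\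
    forall x, `|x| <= 1 -> `|pg i x| <= M.
  by move=> i; have [M M0 h] := continuous_ball_bounded (cpg i) 1; exists M.
pose C := Mw * \sum_i (Md i + 600 * Mp + 72 * Mg i).
have C0 : 0 <= C.
  apply: mulr_ge0 => //; apply: sumr_ge0 => i _.
  have [d0 _] := MdP i; have [g0 _] := MgP i.
  by rewrite addr_ge0 ?addr_ge0 ?mulr_ge0 ?ler0n.
have bwp : bnd_supp (w \* lap pd).
  have [_ CC] := Cp.
  apply: (@bnd_supp_cutoffM _ _ setT w (lap pd) L) => //.
  - by move=> x _; exact: cw.
  - by move=> x; apply: lap_continuous Cp _.
  - by move=> x /(_ I).
  - move=> x Lx; rewrite /lap big1// => i _.
    have near0 : \forall y \near x, phi y = 0 by apply: filterS (near_gt_norm Lx).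
    by have [_ /nbhs_singleton] := C2_data_near0 i Cp near0.
suff eps e : 0 < e -> 2 * e < 1 -> gint m <= - gint (w \* lap pd) + C * 6 ^+ n * e.
  apply/ler_addgt0Pr => t t0.
  have K0 : 0 <= C * 6 ^+ n by rewrite mulr_ge0// exprn_ge0.
  pose e := Num.min 4^-1 (t / (C * 6 ^+ n + 1)).
  have e0 : 0 < e by rewrite lt_min half.1 divr_gt0// ltr_wpDl.
  apply: le_trans (eps e e0 _) _.
    by rewrite (le_lt_trans _ half.2)// ler_pM2l// ge_min lexx.
  rewrite lerD2l; apply: (@le_trans _ _ (C * 6 ^+ n * (t / (C * 6 ^+ n + 1)))).
    by rewrite ler_wpM2l// ge_min lexx orbT.
  by rewrite mulrCA ger_pMr// ler_pdivrMr ?mul1r ?lerDl// ltr_wpDl.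
move=> e0 e1.
have [z [g [d [Cz z01 zfar zd [_ [pzg [pzd [Cpz pzdE gm]]]]]]]] := near_bound e e0 e1.
apply: le_trans gm _; rewrite -lerBlDl opprK addrC.
(* [E] collects the terms of the Laplacian of the product that involve a derivative
   of the cutoff, and the defect of the cutoff itself. *)
pose E := w \* (lap pd \- lap pzd).
have Efar x : 2 * e < `|x| -> E x = 0.
  move=> /zfar[zx gd]; rewrite /E /= /lap pzdE -sumrB big1 ?mulr0// => i _ /=.
  by have [-> ->] := gd i; rewrite zx !mulr0 add0r mul1r addr0 subrr.
have ei2 : 1 <= e ^- 2.
  by rewrite invf_ge1 ?exprn_gt0// expr_le1// ltW//; lra.
have EM x : `|E x| <= C * e ^- 2.
  have [x2|/Efar->] := leP `|x| (2 * e); last first.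
    by rewrite normr0 mulr_ge0// (le_trans ler01).
  have x1 : `|x| <= 1 by rewrite (le_trans x2)// ltW.
  rewrite normrM -mulrA; apply: ler_pM => //; first exact: wM.
  rewrite /= /lap -sumrB mulr_suml.
  apply: le_trans (ler_norm_sum _ _ _) _; apply: ler_sum => i _; rewrite pzdE /=.
  have [Md0 /(_ x x1) dM] := MdP i; have [Mg0 /(_ x x1) gM] := MgP i.
  have [zg zdd] := zd i x; have /andP[zx0 zx1] := z01 x.
  have -> : pd i x - (phi x * d i x + z x * pd i x + 2 * (pg i x * g i x)) =
     (1 - z x) * pd i x - phi x * d i x - 2 * (pg i x * g i x) by ring.
  apply: (@le_trans _ _ (Md i + Mp * (600 / e ^+ 2) + 2 * (Mg i * (36 / e)))).
    rewrite (le_trans (ler_normB _ _))// lerD//.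
      rewrite (le_trans (ler_normB _ _))// lerD//.
        rewrite normrM (le_trans _ dM)// ler_piMl// ger0_norm ?subr_ge0//.
        by rewrite gerBl.
      by rewrite normrM ler_pM// pM.
    by rewrite normrM ger0_norm// ler_pM2l// normrM ler_pM.
  have e_le : e^-1 <= e ^- 2.
    rewrite lef_pV2 ?posrE ?exprn_gt0// expr2 ger_pMr// ltW//; lra.
  have h1 : Md i <= Md i * e ^- 2 by rewrite ler_peMr.
  have h2 : Mg i * e^-1 <= Mg i * e ^- 2 by rewrite ler_wpM2l.
  by clear - h1 h2; move: (e^-1) (e ^- 2) h1 h2 => s t h1 h2; lra.
have -> : gint (w \* lap pd) - gint (w \* lap pzd) = gint E.
  have bE : bnd_supp E.
    exists (2 * e), (C * e ^- 2); split=> //.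
    - by rewrite mulr_ge0// ltW.
    - by rewrite mulr_ge0// (le_trans ler01).
  have -> : w \* lap pzd = w \* lap pd \+ -1 \*o E.
    by apply/funext => x; rewrite /E /=; ring.
  rewrite gintD ?gintZ//; last exact: bnd_suppZ.
  by rewrite mulN1r opprD opprK addrA subrr add0r.
have e20 : 0 < 2 * e by rewrite mulr_gt0.
have Ce0 : 0 <= C * e ^- 2 by rewrite mulr_ge0// (le_trans ler01).
apply: le_trans (ler_norm _) _; apply: le_trans (gint_bound e20 Ce0 EM Efar) _.
have -> : 3 * (2 * e) = 6 * e by ring.
rewrite exprMn -(mulrA C) -(mulrA C); apply: ler_wpM2l => //.
rewrite mulrCA; apply: ler_wpM2l; first by rewrite exprn_ge0.
have -> : e ^- 2 * e ^+ n = e * e ^+ (n - 3).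
  rewrite -[in LHS](subnK n3) exprD; field.
  by rewrite lt0r_neq0.
by rewrite ger_pMr// exprn_ile1 ?(ltW e0)//; lra.
Qed.

(** * Functions of class C^k *)

Lemma Ck_continuous (R : realType) (n k : nat) (D : set 'rV[R]_n) f :
  Ck k D f -> forall x, D x -> {for x, continuous f}.
Proof. by case: k => [|k] []. Qed.

Lemma Ck_subset (R : realType) (n k : nat) (D D' : set 'rV[R]_n) f :
  D' `<=` D -> Ck k D f -> Ck k D' f.
Proof.
move=> DD; elim: k f => [|k IH] f [cf Cf]; split=> //; try by move=> x /DD; exact: cf.
by move=> i; have [df Cpf] := Cf i; split; [move=> x /DD; exact: df|exact: IH].
Qed.

Lemma Ck_le (R : realType) (n k l : nat) (D : set 'rV[R]_n) f :
  (k <= l)%N -> Ck l D f -> Ck k D f.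
Proof.
elim: k l f => [|k IH] l f kl Cf; first by split=> //; exact: Ck_continuous Cf.
case: l kl Cf => // l kl [cf Cf]; split=> // i; have [df Cpf] := Cf i.
by split=> //; exact: IH Cpf.
Qed.

(** Equality on [D] suffices because an open [D] contains a neighbourhood of each of
    its points, on which the partial derivatives only depend. It is what makes
    the derivative of a sum, known on [D] alone, usable inside [Ck]. *)
Lemma Ck_ext (R : realType) (n k : nat) (D : set 'rV[R]_n) f h :
  open D -> (forall x, D x -> f x = h x) -> Ck k D f -> Ck k D h.
Proof.
move=> oD.
have near_eq (f' h' : 'rV[R]_n -> R) : (forall x, D x -> f' x = h' x) ->
    forall x, D x -> \forall y \near x, f' y = h' y.
  by move=> fh x Dx; apply: filterS (open_nbhs_nbhs (conj oD Dx)) => y; exact: fh.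
have cont j (f' h' : 'rV[R]_n -> R) : (forall x, D x -> f' x = h' x) -> Ck j D f' ->
    forall x, D x -> {for x, continuous h'}.
  move=> fh Cf x Dx; have cf := Ck_continuous Cf Dx.
  change (h' y @[y --> x] --> h' x); rewrite -(fh x Dx).
  by apply: cvg_trans cf; exact: near_eq_cvg (near_eq _ _ fh x Dx).
elim: k f h => [|k IH] f h fh Cf; first by split=> //; exact: cont fh Cf.
split; first exact: cont fh Cf.
move=> i; have [df Cpf] := Cf.2 i; split=> [x Dx|].
  by apply: near_eq_derivable (df x Dx); exact: near_eq.
by apply: IH Cpf => x Dx; apply: near_eq_derive; exact: near_eq.
Qed.

Lemma CkD (R : realType) (n k : nat) (D : set 'rV[R]_n) f h :
  open D -> Ck k D f -> Ck k D h -> Ck k D (fun x => f x + h x).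
Proof.
move=> oD.
have cont j (f' h' : 'rV[R]_n -> R) : Ck j D f' -> Ck j D h' ->
    forall x, D x -> {for x, continuous (fun x => f' x + h' x)}.
  move=> Cf Ch x Dx.
  by apply: continuousD; [exact: Ck_continuous Cf x Dx|exact: Ck_continuous Ch x Dx].
elim: k f h => [|k IH] f h Cf Ch; first by split=> //; exact: cont Cf Ch.
split; first exact: cont Cf Ch.
move=> i; have [df Cpf] := Cf.2 i; have [dh Cph] := Ch.2 i; split=> [x Dx|].
  by apply: derivableD; [exact: df|exact: dh].
apply: Ck_ext oD _ (IH _ _ Cpf Cph) => x Dx.
by rewrite /partial; apply/esym/deriveD; [exact: df|exact: dh].
Qed.

Lemma CkN (R : realType) (n k : nat) (D : set 'rV[R]_n) f :
  open D -> Ck k D f -> Ck k D (fun x => - f x).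
Proof.
move=> oD.
have cont j (f' : 'rV[R]_n -> R) : Ck j D f' ->
    forall x, D x -> {for x, continuous (fun x => - f' x)}.
  by move=> Cf x Dx; apply: continuousN; exact: Ck_continuous Cf x Dx.
elim: k f => [|k IH] f Cf; first by split=> //; exact: cont Cf.
split; first exact: cont Cf.
move=> i; have [df Cpf] := Cf.2 i; split=> [x Dx|].
  by apply: derivableN; exact: df.
apply: Ck_ext oD _ (IH _ Cpf) => x Dx.
by rewrite /partial; apply/esym/deriveN; exact: df.
Qed.

Lemma Ck0 (R : realType) (n k : nat) (D : set 'rV[R]_n) : Ck k D (fun=> 0).
Proof.
elim: k => [|k IH]; first by split=> // x _; exact: cst_continuous.
split=> [x _|i]; first exact: cst_continuous.
split=> [x _|]; first exact: derivable_cst.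
by rewrite (_ : partial i _ = fun=> 0)//; apply/funext => x; exact: derive_cst.
Qed.

Lemma Ck_laplacian (R : realType) (n k : nat) (D : set 'rV[R]_n) f :
  open D -> Ck k.+2 D f -> Ck k D (laplacian f).
Proof.
move=> oD Cf; suff aux (s : seq 'I_n) :
    Ck k D (fun x => \sum_(i <- s) partial i (partial i f) x) by exact: aux.
elim: s => [|i s IH].
  by rewrite (_ : (fun x => _) = fun=> 0); [exact: Ck0|apply/funext => x; rewrite big_nil].
rewrite (_ : (fun x => _) = fun x => partial i (partial i f) x +
    \sum_(i <- s) partial i (partial i f) x).
  by apply: CkD => //; have [_ /(_ i)[_ [_ /(_ i)[]]]] := Cf.
by apply/funext => x; rewrite big_cons.
Qed.

Lemma Ck_neg_laplacian_iter (R : realType) (n j k : nat) (D : set 'rV[R]_n) f :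
  open D -> Ck (k + 2 * j) D f -> Ck k D (neg_laplacian_iter j f).
Proof.
move=> oD; elim: j k => [|j IH] k; first by rewrite muln0 addn0.
rewrite (_ : (k + 2 * j.+1 = k.+2 + 2 * j)%N); last by lia.
by move=> /IH Cf; apply: CkN => //; exact: Ck_laplacian.
Qed.

Lemma Ck2_C2_data (R : realType) (n : nat) (D : set 'rV[R]_n) f : Ck 2 D f ->
  C2_data D f (fun i => partial i f) (fun i => partial i (partial i f)).
Proof.
move=> [cf Cf]; split=> // i x Dx; have [df [cpf /(_ i)[dpf [cppf _]]]] := Cf i.
split; [|  |exact: cpf|exact: cppf].
  by apply: derivableP; exact: df.
by apply: derivableP; exact: dpf.
Qed.

(** * Moments of iterated Laplacians *)

(** What remains of [w = (-Delta)^j u] after moving all the derivatives onto the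
    bumps. The constant must depend neither on the centre nor on the radius. *)
Definition moments_controlled (R : realType) (n : nat) (u w : 'rV[R]_n -> R) (j : nat) :=
  forall k, exists2 C : R, 0 <= C & forall c r, 0 < r ->
    `|gint (w \* pbump c r (k + 2 * j).+1)|
      <= C * r ^- (2 * j) * gint (u \* pbump c r k.+1).

(** One more Laplacian costs a factor [r ^- 2] and two units of the exponent. The
    conclusion is about the Laplacian of the bump, not that of [w], so that it
    also applies to a [w] which is not twice differentiable at the origin. *)
Lemma lap_moments_controlled (R : realType) (n : nat) (u w : 'rV[R]_n -> R) j :
  continuous u -> (forall x, 0 <= u x) -> continuous w -> moments_controlled u w j ->
  forall k, exists2 C : R, 0 <= C & forall c r, 0 < r -> exists g d,
    C2_data setT (pbump c r (k + 2 * j).+3) g d /\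
    `|gint (w \* lap d)| <= C * r ^- (2 * j.+1) * gint (u \* pbump c r k.+1).
Proof.
move=> cu u0 cw wj k; have [C1 C10 h1] := wj k; have [C2 C20 h2] := wj k.+1.
set K := (k + 2 * j)%N.
pose A : R := 4 * K.+3%:R * K.+2%:R; pose B : R := K.+3%:R * (4 * K.+2%:R + 2 * n%:R).
have A0 : 0 <= A by rewrite !mulr_ge0.
have B0 : 0 <= B by rewrite mulr_ge0// addr_ge0// mulr_ge0.
exists (A * C1 + B * C2); first by rewrite addr_ge0// mulr_ge0.
move=> c r r0; have [g [d [Cd E]]] := @gint_lap_bump R n c r K r0.
exists g, d; split=> //; rewrite E; last exact: continuous_ball_bounded.
rewrite -/A -/B.
have {h1} := h1 c r r0; have {h2} := h2 c r r0; rewrite addSn -/K.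
move: (gint (w \* _)) => y; move: (gint (w \* _)) => z h2 h1.
have rj : 0 <= r ^- (2 * j) by rewrite invr_ge0 exprn_ge0// ltW.
have mono : gint (u \* pbump c r k.+2) <= gint (u \* pbump c r k.+1).
  apply: le_gint; try by apply: bnd_suppM; [exact: continuous_ball_bounded|exact: bnd_supp_bump].
  by move=> x /=; rewrite ler_wpM2l// bump_le.
have {}h2 : `|y| <= C2 * r ^- (2 * j) * gint (u \* pbump c r k.+1).
  by apply: le_trans h2 _; rewrite ler_wpM2l// mulr_ge0.
rewrite normrM ger0_norm ?invr_ge0 ?sqr_ge0//.
have -> : r ^- (2 * j.+1) = r ^- 2 * r ^- (2 * j).
  by rewrite mulnS exprD invfM.
move: A B A0 B0 {E} => A B A0 B0.
set rho := r ^- (2 * j) in rj h1 h2 *; set J := gint _ in h1 h2 *.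
have h : `|A * z - B * y| <= (A * C1 + B * C2) * rho * J.
  apply: le_trans (ler_normB _ _) _; rewrite !normrM (ger0_norm A0) (ger0_norm B0).
  have -> : (A * C1 + B * C2) * rho * J = A * (C1 * rho * J) + B * (C2 * rho * J) by ring.
  by rewrite lerD// ler_wpM2l.
have -> : (A * C1 + B * C2) * (r ^- 2 * rho) * J = r ^- 2 * ((A * C1 + B * C2) * rho * J).
  by ring.
by rewrite ler_wpM2l// invr_ge0 sqr_ge0.
Qed.

Lemma iter_moments_controlled (R : realType) (n N : nat) (U : nat -> 'rV[R]_n -> R) G H :
  (forall x, 0 <= U 0%N x) -> (forall j, (j <= N)%N -> continuous (U j)) ->
  (forall j, (j < N)%N -> C2_data setT (U j) (G j) (H j) /\
     forall x, U j.+1 x = - lap (H j) x) ->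
  forall j, (j <= N)%N -> moments_controlled (U 0%N) (U j) j.
Proof.
move=> U0 cU CU; elim=> [|j IH] jN k.
  exists 1 => // c r r0; rewrite muln0 addn0 expr0 invr1 !mul1r ger0_norm//.
  apply: gint_ge0; first by apply: bnd_suppM; [exact: continuous_ball_bounded (cU _ _)|exact: bnd_supp_bump].
  by move=> x; rewrite mulr_ge0// bump_ge0.
have [C C0 h] := lap_moments_controlled (cU 0%N (leq0n _)) U0 (cU j (ltnW jN)) (IH (ltnW jN)) k.
exists C => // c r r0; have [g [d [Cd hd]]] := h c r r0.
have [CUj UE] := CU j jN.
have -> : (k + 2 * j.+1).+1 = (k + 2 * j).+3 by lia.
rewrite (_ : U j.+1 \* _ = -1 \*o (lap (H j) \* pbump c r (k + 2 * j).+3)); last first.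
  by apply/funext => x /=; rewrite UE mulN1r mulNr.
have nT (x : 'rV[R]_n) : ~ setT x -> \forall y \near x, pbump c r (k + 2 * j).+3 y = 0.
  by move=> /(_ I).
have bl : bnd_supp (lap (H j) \* pbump c r (k + 2 * j).+3).
  apply: (@bnd_supp_cutoffM _ _ setT _ _ (`|c| + r)) => //.
  - by move=> x; exact: lap_continuous CUj.
  - exact: bump_continuous.
  - by move=> x; exact: bump_supp.
rewrite gintZ// mulN1r normrN.
by rewrite -(green CUj Cd nT (fun x => bump_supp _ r0)).
Qed.

Lemma bump_moment_le (R : realType) (n : nat) (c : 'rV[R]_n) (r : R) j : 0 < r ->
  gint (pbump c r 2) <= n.+1%:R ^+ j * gint (pbump c r j.+2).
Proof.
move=> r0; elim: j => [|j IH]; first by rewrite expr0 mul1r.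
apply: le_trans IH _; rewrite exprSr -mulrA ler_wpM2l ?exprn_ge0//.
have b0 : 0 <= gint (pbump c r j.+3).
  by apply: gint_ge0; [exact: bnd_supp_bump|move=> x; exact: bump_ge0].
have x0 : 0 < 4 * j.+3%:R :> R by rewrite mulr_gt0// ltr0n.
rewrite -(ler_pM2l x0) bump_moment_rec// mulrA ler_wpM2r//.
have x2 : 2 <= 4 * j.+3%:R :> R by rewrite -natrM ler_nat; lia.
rewrite -(addn1 n) natrD; move: (4 * _) x2 => x x2.
by rewrite [leRHS]mulrDr mulr1 [leRHS]addrC lerD2l ler_wpM2r.
Qed.

(** Where the term [u `^ p] does not already win, [u * t ^+ (M * N)] is bounded by a
    power of [K], for [N] large; hence the choice [l = M * N + 2]. *)
Lemma young_weighted (R : realType) (p : R) (M : nat) : 1 < p ->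
  exists2 l, (2 <= l)%N & forall K : R, 0 < K -> exists2 C : R, 0 <= C &
    forall u t : R, 0 <= u -> 0 <= t -> t <= 1 ->
      K * (u * t ^+ l) <= u `^ p * t ^+ (l + M) + C * t ^+ 2.
Proof.
move=> p1; have q0 : 0 < p - 1 by rewrite subr_gt0.
(* With [N * (p - 1) >= 1], the bound [u `^ (p - 1) * t ^+ M < K] passes to
   [(u * t ^+ (M * N)) `^ (p - 1)]. *)
pose N := (Num.truncn (p - 1)^-1).+1.
have Nq : 1 <= N%:R * (p - 1).
  by rewrite -ler_pdivrMr// mul1r ltW// truncnS_gt.
exists (2 + M * N)%N => // K K0.
pose Y := K `^ (p - 1)^-1.
exists (K * Y); first by rewrite mulr_ge0 ?powR_ge0// ltW.
move=> u t u0 t0 t1.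
have [le|lt] := leP (K * (u * t ^+ (2 + M * N))) (u `^ p * t ^+ (2 + M * N + M)).
  by rewrite (le_trans le)// lerDl !mulr_ge0 ?powR_ge0 ?exprn_ge0// ltW.
suff h : K * (u * t ^+ (2 + M * N)) <= K * Y * t ^+ 2.
  by rewrite (le_trans h)// lerDr mulr_ge0 ?powR_ge0 ?exprn_ge0.
have KY : 0 <= K * Y by rewrite mulr_ge0 ?powR_ge0// ltW.
have [->|tn0] := eqVneq t 0; first by rewrite !expr0n /= !mulr0.
have tp : 0 < t by rewrite lt_neqAle eq_sym tn0.
have [->|un0] := eqVneq u 0; first by rewrite mul0r mulr0 mulr_ge0 ?exprn_ge0.
have up : 0 < u by rewrite lt_neqAle eq_sym un0.
rewrite -mulrA ler_pM2l// exprD mulrCA mulrC ler_pM2r ?exprn_gt0//.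
have lt' : u `^ (p - 1) * t ^+ M < K.
  move: lt; rewrite -(mulr_powRB1 u0 (lt_trans ltr01 p1)) exprD.
  have ut : 0 < u * t ^+ (2 + M * N) by rewrite mulr_gt0// exprn_gt0.
  have -> : u * u `^ (p - 1) * (t ^+ (2 + M * N) * t ^+ M) =
    u * t ^+ (2 + M * N) * (u `^ (p - 1) * t ^+ M) by ring.
  by rewrite [K * _]mulrC ltr_pM2l.
set y := u * t ^+ (M * N).
have y0 : 0 <= y by rewrite mulr_ge0 ?exprn_ge0.
have yK : y `^ (p - 1) <= K.
  apply: le_trans (ltW lt'); rewrite powRM ?exprn_ge0// ler_wpM2l ?powR_ge0//.
  rewrite -!powR_mulrn// -powRrM natrM -mulrA.
  by apply: ger_powR; [rewrite tp|rewrite ler_peMr].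
have yE : (y `^ (p - 1)) `^ (p - 1)^-1 = y.
  by rewrite -powRrM mulfV ?powRr1// gt_eqF.
rewrite -[leLHS]yE; apply: ge0_ler_powR; rewrite ?nnegrE ?powR_ge0//.
  by rewrite invr_ge0 ltW.
exact: ltW.
Qed.

(** * Boundedness of the averages and positivity *)

Lemma enormE (R : realType) (n : nat) (x : 'rV[R]_n) : enorm x = Num.sqrt (sqdist 0 x).
Proof. by congr Num.sqrt; apply: eq_bigr => i _; rewrite mxE subr0. Qed.

Lemma weakly_superharmonic_punctured (R : realType) (n : nat) (w : 'rV[R]_n -> R) wg wd :
  (3 <= n)%N -> continuous w ->
  C2_data [set x | x != 0] w wg wd -> (forall x, x != 0 -> lap wd x <= 0) ->
  weakly_superharmonic w.
Proof.
move=> n3 cw Cw w0 phi g d L Cp phi0 phiL.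
have [bm gm] := green_punctured n3 cw Cw w0 Cp phi0 phiL.
rewrite -oppr_ge0; apply: le_trans gm; apply: gint_ge0 => // x /=.
case: ifP => [x1|_]; last by rewrite mul0r.
rewrite mulr_ge0// oppr_ge0 w0//; apply/eqP => x0.
by move: x1; rewrite x0 normr0 ler10.
Qed.

(** Here [w] is [(-Delta)^(m-1) u] with [m = j.+1]. Testing the equation against a
    bump bounds the moment of [|x|^-a u^p] by [C r ^- (2 m)] times a moment of
    [u], and by Young's inequality the latter is, up to the volume of the ball,
    at most half of what the former controls: off the unit ball [|x|^-a] is at
    least [(2 r) ^- (2 m)], which is where [a <= 2 m] enters. *)
Lemma average_bound (R : realType) (n j : nat) (a p : R) (u w : 'rV[R]_n -> R) wg wd :
  (3 <= n)%N -> 1 < p -> a <= (2 * j.+1)%:R ->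
  continuous u -> (forall x, 0 <= u x) -> continuous w -> moments_controlled u w j ->
  C2_data [set x | x != 0] w wg wd ->
  (forall x, x != 0 -> - lap wd x = u x `^ p / enorm x `^ a) ->
  exists2 l, (2 <= l)%N & exists2 C : R, 0 <= C & forall c r, 1 <= r ->
    sqdist 0 c <= r ^+ 2 ->
    gint (u \* pbump c r l) <= C * gint (pbump c r 2).
Proof.
have idx k : (k.+1 + 2 * j).+3 = (k.+2 + 2 * j.+1)%N by lia.
move=> n3 p1 am cu u0 cw wj Cw weq.
have [[//|[//|k]] l2 young] := young_weighted (2 * j.+1) p1; exists k.+2 => //.
have wd0 x : x != 0 -> lap wd x <= 0.
  by move=> x0; rewrite -oppr_ge0 weq// mulr_ge0 ?powR_ge0// invr_ge0 powR_ge0.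
have [C1 C10 hC] := lap_moments_controlled cu u0 cw wj k.+1.
(* [C] is divided by in the end, hence must be positive. *)
pose C := C1 + 1; have C0 : 0 < C by rewrite ltr_wpDl.
pose D : R := 2 ^+ (2 * j.+1); have D0 : 0 < D by rewrite exprn_gt0.
have K0 : 0 < 2 * C * D by rewrite !mulr_gt0.
have [CY CY0 {}young] := young (2 * C * D) K0.
have [Mu Mu0 uM] := continuous_ball_bounded cu 1.
pose C3 := CY / D + 2 * C * Mu.
have C30 : 0 <= C3.
  by rewrite addr_ge0 ?divr_ge0 ?mulr_ge0 ?(ltW D0) ?(ltW C0).
exists (C3 / C); first by rewrite divr_ge0// ltW.
move=> c r r1 cr; have r0 : 0 < r by exact: lt_le_trans r1.
have [g [d [Cd hd]]] := hC c r r0.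
have := green_punctured n3 cw Cw wd0 Cd (fun x => bump_ge0 _ _ _ _)
  (fun x => bump_supp _ r0).
set m := (fun x => _) \* _ => -[bm gm].
pose rm := r ^+ (2 * j.+1); have rm0 : 0 < rm by rewrite exprn_gt0.
have bb l : bnd_supp (pbump c r l.+1) by exact: bnd_supp_bump.
have bu l : bnd_supp (u \* pbump c r l.+1).
  by apply: bnd_suppM => //; exact: continuous_ball_bounded.
(* The factor 2 leaves one copy of the left-hand side after [rm * gint m] has been
   bounded by [C] times its integral. Off the unit ball this is Young's
   inequality; inside, [m] vanishes and [u] is bounded by [Mu]. *)
have pointwise x : (2 * C \*o (u \* pbump c r k.+2)) x <=
    (rm \*o m \+ C3 \*o pbump c r 2) x.
  rewrite /= /m /=; set t := Num.max (1 - sqdist c x / r ^+ 2) 0.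
  have t0 : 0 <= t by rewrite le_max lexx orbT.
  have t1 : t <= 1 by rewrite ge_max ler01 bump_base_le1.
  have bE l : pbump c r l x = t ^+ l by [].
  rewrite !bE; have [x1|x1] := leP 1 `|x|; last first.
    rewrite mul0r mulr0 add0r.
    apply: (@le_trans _ _ (2 * C * (Mu * t ^+ 2))).
      rewrite ler_wpM2l ?mulr_ge0 ?(ltW C0)//; apply: ler_pM => //.
      - by rewrite exprn_ge0.
      - by rewrite (le_trans (ler_norm _))// uM// ltW.
      - by rewrite ler_wiXn2l.
    rewrite mulrA ler_wpM2r ?exprn_ge0// lerDr divr_ge0// ltW//.
  have x0 : x != 0 by apply/eqP => x0; move: x1; rewrite x0 normr0 ler10.
  rewrite weq//.
  have [tz|tn0] := eqVneq t 0; first by rewrite tz !expr0n /= !mulr0 addr0.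
  have sx : sqdist c x <= r ^+ 2.
    rewrite leNgt; apply/negP => sx; move/eqP: tn0; apply.
    by rewrite /t max_r// subr_le0 ler_pdivlMr ?exprn_gt0// mul1r ltW.
  have e1 : 1 <= enorm x.
    apply: le_trans x1 _; rewrite enormE -[x in `|x|]subr0; exact: norm_le_sqdist.
  have e2 : enorm x <= 2 * r.
    rewrite -(ler_pXn2r (n := 2)) ?nnegrE ?mulr_ge0 ?(ltW r0) ?(le_trans _ e1)//.
    rewrite enormE sqr_sqrtr ?sqdist_ge0// exprMn.
    by apply: le_trans (sqdist_le2 c x 0) _; lra.
  have ea : enorm x `^ a <= D * rm.
    apply: le_trans (ler_powR e1 am) _; rewrite powR_mulrn ?(le_trans _ e1)//.
    by rewrite -exprMn lerXn2r ?nnegrE ?mulr_ge0 ?(ltW r0) ?(le_trans _ e1).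
  have ea0 : 0 < enorm x `^ a by rewrite powR_gt0// (lt_le_trans _ e1).
  have key : D^-1 * (u x `^ p * t ^+ (k.+2 + 2 * j.+1)) <=
      rm * (u x `^ p / enorm x `^ a * t ^+ (k.+1 + 2 * j).+3).
    rewrite idx.
    have X0 : 0 <= u x `^ p * t ^+ (k.+2 + 2 * j.+1) by rewrite mulr_ge0 ?powR_ge0 ?exprn_ge0.
    move: (u x `^ p) (t ^+ _) (enorm x `^ a) ea ea0 X0 => U T E ea ea0 X0.
    have -> : rm * (U / E * T) = (U * T) * (rm / E) by ring.
    rewrite mulrC; apply: ler_wpM2l => //.
    by rewrite ler_pdivlMr// mulrC ler_pdivrMr// mulrC.
  apply: le_trans (lerD key (lexx _)).
  have := young (u x) t (u0 x) t0 t1.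
  move: (u x `^ p * _) (u x * _) => U X h.
  apply: (@le_trans _ _ (D^-1 * (U + CY * t ^+ 2))).
    have -> : 2 * C * X = D^-1 * (2 * C * D * X) by field; rewrite gt_eqF.
    by rewrite ler_pM2l ?invr_gt0.
  rewrite mulrDr lerD2l mulrA; apply: ler_wpM2r; first exact: exprn_ge0.
  by rewrite mulrC /C3 lerDl !mulr_ge0// ltW.
have := le_gint (bnd_suppZ _ (bu _)) (bnd_suppD (bnd_suppZ _ bm) (bnd_suppZ _ (bb _))) pointwise.
rewrite gintD; [|exact: bnd_suppZ|exact: bnd_suppZ].
rewrite !gintZ// => main.
have J0 : 0 <= gint (u \* pbump c r k.+2).
  by apply: gint_ge0 => // x; rewrite mulr_ge0// bump_ge0.
have gm' : rm * gint m <= C * gint (u \* pbump c r k.+2).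
  have {}gm : gint m <= C1 * r ^- (2 * j.+1) * gint (u \* pbump c r k.+2).
    by rewrite (le_trans gm)// (le_trans _ hd)// -normrN ler_norm.
  rewrite -(ler_pM2l rm0) in gm; apply: le_trans gm _.
  rewrite -/rm mulrA [rm * _]mulrC divfK ?gt_eqF// ler_wpM2r// lerDl//.
rewrite -(ler_pM2l C0) mulrA [C * (_ / _)]mulrC divfK ?gt_eqF//; lra.
Qed.

(** By the mean value inequality [w c] is at least the mean of [w] against a bump of
    radius [r], which is [O(r ^- (2 * j.+1))] since the means of [u] are bounded;
    let [r] tend to infinity. *)
Lemma superharmonic_ge0 (R : realType) (n j l : nat) (u w : 'rV[R]_n -> R) (C : R) :
  continuous u -> (forall x, 0 <= u x) -> continuous w -> weakly_superharmonic w ->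
  moments_controlled u w j.+1 -> (2 <= l)%N ->
  0 <= C -> (forall c r, 1 <= r -> sqdist 0 c <= r ^+ 2 ->
    gint (u \* pbump c r l) <= C * gint (pbump c r 2)) ->
  forall c, 0 <= w c.
Proof.
move=> cu u0 cw sw wj; case: l => [//|[//|k]] _ C0 avg c.
have [C1 C10 hC] := wj k.+1.
pose K := (k.+1 + 2 * j.+1)%N.
pose C2 := C1 * (C * n.+1%:R ^+ K.-1).
have C20 : 0 <= C2 by rewrite !mulr_ge0 ?exprn_ge0.
have [M M0 sM] := continuous_ball_bounded (@sqdist_continuous R n c) 1.
(* The lower bound on [r] gives [1 <= r], [sqdist 0 c <= r ^+ 2], and a bump that is at
   least [2 ^- K.+1] on the unit cube. *)
suff low r : 1 + sqdist 0 c + 2 * M <= r -> - (C2 / r) <= w c.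
  rewrite leNgt; apply/negP => wc.
  pose r := 1 + sqdist 0 c + 2 * M + C2 / (- w c).
  have q0 : 0 <= C2 / (- w c) by rewrite divr_ge0// oppr_ge0 ltW.
  have s0 := sqdist_ge0 0 c.
  have := low r; rewrite /r lerDl q0 => /(_ isT); rewrite -/r.
  have r0 : 0 < r by rewrite /r; lra.
  have : C2 / r < - w c.
    rewrite ltr_pdivrMr// mulrC -ltr_pdivrMr ?oppr_gt0// /r; lra.
  lra.
move=> rl; have s0 := sqdist_ge0 0 c.
have r1 : 1 <= r by lra.
have r0 : 0 < r by exact: lt_le_trans r1.
have rr : r <= r ^+ 2 by rewrite expr2 ler_peMr// ltW.
have b0 : 0 < gint (pbump c r K.+1).
  have h : 0 < (2^-1 : R) ^+ K.+1 by rewrite exprn_gt0.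
  apply: lt_le_trans h _; apply: gint_unit_box => [||x|x x1].
  - exact: bnd_supp_bump.
  - by rewrite exprn_ge0.
  - exact: bump_ge0.
  have half : 2^-1 <= 1 - sqdist c x / r ^+ 2.
    have : sqdist c x / r ^+ 2 <= 2^-1; last by lra.
    rewrite ler_pdivrMr ?exprn_gt0//.
    have := le_trans (ler_norm _) (sM x x1); lra.
  rewrite /pbump /pospow lerXn2r ?nnegrE ?le_max ?half//.
  by rewrite (le_trans _ half).
rewrite -(ler_pM2r b0).
apply: le_trans (superharmonic_mean_le c K cw sw r0).
have := hC c r r0; rewrite -/K => h; rewrite mulNr lerNl.
apply: le_trans (ler_norm _) _; rewrite normrN; apply: le_trans h _.
have cr : sqdist 0 c <= r ^+ 2 by lra.
have h1 := avg c r r1 cr.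
have h2 : gint (pbump c r 2) <= n.+1%:R ^+ K.-1 * gint (pbump c r K.+1).
  by have := bump_moment_le c K.-1 r0; rewrite (_ : K.-1.+2 = K.+1)//; lia.
have h3 : gint (u \* pbump c r k.+2) <= C * n.+1%:R ^+ K.-1 * gint (pbump c r K.+1).
  by rewrite (le_trans h1)// -mulrA ler_wpM2l.
have ri : r ^- (2 * j.+1) <= r^-1.
  rewrite lef_pV2 ?posrE ?exprn_gt0// mulnS -[leLHS]expr1.
  by rewrite ler_weXn2l.
have -> : C2 / r * gint (pbump c r K.+1) =
    C1 * r^-1 * (C * n.+1%:R ^+ K.-1 * gint (pbump c r K.+1)) by rewrite /C2; ring.
apply: ler_pM => //.
- by rewrite mulr_ge0// invr_ge0 exprn_ge0// ltW.
- apply: gint_ge0; first by apply: bnd_suppM; [exact: continuous_ball_bounded|exact: bnd_supp_bump].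
  by move=> x; rewrite mulr_ge0// bump_ge0.
- by rewrite ler_wpM2l.
Qed.

Lemma solution_off_origin (R : realType) (n m : nat) (a p : R) (u : 'rV[R]_n -> R) :
  nonneg_classical_solution m a p u ->
  [/\ forall x, 0 <= u x, Ck (2 * m) [set x | x != 0] u, Ck (2 * m - 2) setT u
    & forall x, x != 0 -> hardy_henon_eq m a p u x].
Proof.
move=> [u0 neg pos]; have [/neg[Cu eq]|/pos[Cu Cu' eq]] := leP a 0; last by split.
split=> //; first exact: Ck_subset Cu.
by apply: Ck_le Cu; exact: leq_subr.
Qed.

Theorem theorem2p1 (R : realType) (n m : nat) (a p : R) (u : 'rV[R]_n -> R)
    (n_ge3 : (3 <= n)%N) (m_ge1 : (1 <= m)%N) (m_lt : (2 * m < n)%N)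
    (a_lt : a < (2 * m)%:R) (p_gt1 : 1 < p)
    (u_sol : nonneg_classical_solution m a p u)
    (a_or_growth : a <= 2 + 2 * p \/
      (u : 'rV[R]_n -> R^o) =o_ (at_infty R n) (fun x => enorm x ^+ 2 : R^o)) :
  forall i : nat, (1 <= i <= m.-1)%N ->
    forall x : 'rV[R]_n, 0 <= neg_laplacian_iter i u x.
Proof.
have [u0 CuD CuT ueq] := solution_off_origin u_sol.
case: m m_ge1 m_lt a_lt u_sol CuD CuT ueq => // m _ _ a_lt _ CuD CuT ueq.
have oD : open [set x : 'rV[R]_n | x != 0].
  rewrite (_ : [set _ | _] = Num.norm @^-1` [set y : R | 0 < y]).
    by apply: open_comp => [x _|]; [exact: norm_continuous|exact: open_gt].
  by apply/seteqP; split=> x /=; rewrite normr_gt0.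
pose U j := neg_laplacian_iter j u.
pose G j i := partial i (U j); pose H j i := partial i (G j i).
have cU j : (j <= m)%N -> continuous (U j).
  move=> jm x; have CU : Ck 0 setT (U j).
    by apply: Ck_neg_laplacian_iter openT _; apply: Ck_le CuT; lia.
  exact: Ck_continuous CU x I.
have CU j : (j < m)%N -> C2_data setT (U j) (G j) (H j).
  move=> jm; apply: Ck2_C2_data.
  by apply: Ck_neg_laplacian_iter openT _; apply: Ck_le CuT; lia.
have CUD j : (j <= m)%N -> C2_data [set x | x != 0] (U j) (G j) (H j).
  move=> jm; apply: Ck2_C2_data.
  by apply: Ck_neg_laplacian_iter oD _; apply: Ck_le CuD; lia.
have moments := iter_moments_controlled u0 cU (fun j jm => conj (CU j jm) (fun=> erefl)).
have [l l2 [C C0 avg]] := average_bound n_ge3 p_gt1 (ltW a_lt) (cU 0%N (leq0n _)) u0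
  (cU m (leqnn _)) (moments m (leqnn _)) (CUD m (leqnn _)) ueq.
have step j : (j < m)%N -> (forall x, x != 0 -> 0 <= U j.+2 x) ->
    forall x, 0 <= U j.+1 x.
  move=> jm Upos; apply: superharmonic_ge0 (cU 0%N (leq0n _)) u0 (cU _ jm) _ (moments _ jm) l2 C0 avg.
  apply: weakly_superharmonic_punctured n_ge3 (cU _ jm) (CUD _ jm) _ => x /Upos.
  by rewrite -oppr_ge0.
have down d j : (j.+1 + d = m)%N -> forall x, 0 <= U j.+1 x.
  elim: d j => [|d IH] j jd; apply: step; try by lia.
    move: jd; rewrite addn0 => -> x x0; have := ueq x x0.
    by rewrite /hardy_henon_eq /U => ->; rewrite mulr_ge0 ?powR_ge0// invr_ge0 powR_ge0.
  by move=> x _; apply: IH; lia.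
by case=> [//|i] /= im; apply: (down (m - i.+1)%N); lia.
Qed.
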